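(* Let $n=\mathsf r+\mathsf s$ with $\mathsf r,\mathsf s>0$, $x_1\in\mathbb{C}$, and $D=\varpi_{\mathsf s}[x_1]+(\varpi_{\mathsf r}-\varpi_0)[\infty]$. Write $T_D(z)=\begin{pmatrix}A(z)&Q\\ -P&B(z)\end{pmatrix}$ in block form with diagonal blocks of sizes $\mathsf r$ and $\mathsf s$ (so $Q$ is the upper-right $\mathsf r\times\mathsf s$ block and $-P$ the lower-left $\mathsf s\times\mathsf r$ block), and put $F:=zI_{\mathsf r}-A(z)$. Then $P,Q,F$ are independent of $z$ and $F=x_1I_{\mathsf r}+QP$.
   Context: Let $\Lambda=\bigoplus_{j=1}^n\mathbb{Z}\epsilon_j$, $\epsilon^\vee_j$ dual basis, $\alpha_i=\epsilon_i-\epsilon_{i+1}$, $\varpi_i=-\sum_{j=i+1}^n\epsilon_j$. For $D$ as in the claim, $N=1$, $i_1=\mathsf s$, $\gamma_1=1$, $\lambda=\varpi_{\mathsf s}$, $\mu=\varpi_{\mathsf r}-\varpi_0$, and $\lambda+\mu=\sum_{i=1}^{n-1}a_i\alpha_i$ with $a_i\in\mathbb{Z}_{\ge0}$; $a_0=a_n=0$. $\mathcal{A}$: the $\mathbb{C}$-algebra generated by $p_{i,r},e^{\pm q_{i,r}},(p_{i,r}-p_{i,s}+m)^{-1}$ ($1\le i<n$, $1\le r\ne s\le a_i$, $m\in\mathbb{Z}$) with $[e^{\pm q_{i,r}},p_{j,s}]=\mp\delta_{ij}\delta_{rs}e^{\pm q_{i,r}}$, $p$'s commuting, $e^q$'s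 commuting, $e^{\pm q_{i,r}}e^{\mp q_{i,r}}=1$. $Z_i(z)=(z-x_1)$ if $i=\mathsf s$ and $Z_i(z)=1$ otherwise; $P_j(z)=\prod_{r=1}^{a_j}(z-p_{j,r})$, $P_{j,r}(z)=\prod_{s\ne r}(z-p_{j,s})$, $P_0=P_n=1$. $T_D(z)\in\mathcal{A}((z^{-1}))\otimes\mathrm{End}\,\mathbb{C}^n$: $T_D(z)_{\alpha\beta}=\sum_{i=1}^{\min(\alpha,\beta)}f^D_{\alpha i}(z)g^D_i(z)e^D_{i\beta}(z)$, where (expanded in $z^{-1}$) $g^D_i(z)=\frac{P_i(z)}{P_{i-1}(z-1)}\prod_{k=0}^{i-1}Z_k(z)$, $e^D_{ii}=f^D_{ii}=1$ and for $i<j$: $e^D_{ij}(z)=-\sum_{r_i,\dots,r_{j-1}}\frac{P_{i-1}(p_{i,r_i}-1)\prod_{k=i}^{j-2}P_{k,r_k}(p_{k+1,r_{k+1}}-1)}{(z-p_{i,r_i})\prod_{k=i}^{j-1}P_{k,r_k}(p_{k,r_k})}\prod_{k=i}^{j-1}Z_k(p_{k,r_k})\, e^{\sum_{k=i}^{j-1}q_{k,r_k}}$, $f^D_{ji}(z)=\sum_{r_i,\dots,r_{j-1}}\frac{P_j(p_{j-1,r_{j-1}}+1)\prod_{k=i+1}^{j-1}P_{k,r_k}(p_{k-1,r_{k-1}}+1)}{(z-p_{i,r_i}-1)\prod_{k=i}^{j-1}P_{k,r_k}(p_{k,r_k})}\, e^{-\sum_{k=i}^{j-1}q_{k,r_k}}$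 (sums over $1\le r_k\le a_k$). *)

(* Defs.v *)
From HB Require Import structures.
From mathcomp Require Import all_boot all_order all_algebra.
From mathcomp Require Import complex.
From mathcomp Require Import Rstruct.
Set Implicit Arguments. Unset Strict Implicit. Unset Printing Implicit Defensive.
Import Order.TTheory GRing.Theory Num.Theory.
Local Open Scope ring_scope.

Definition CC : fieldType := Rdefinitions.R[i].

(* ---------- Weights: Lambda = Z^n, coordinates indexed by j = 1..n ---------- *)
(* varpi i = - sum_{j=i+1}^n eps_j,  alpha i = eps_i - eps_{i+1}. *)
Definition varpi (i : nat) (j : nat) : int := if (i < j)%N then -1 else 0.
Definition alpha (i : nat) (j : nat) : int := (j == i)%:Z - (j == i.+1)%:Z.

(* LSer d c  represents  z^d * sum_{m>=0} c m z^{-m}  (z central). *)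
Section LSer.
Variable R : ringType.
Record lser := LSer { ldeg : int; lps : nat -> R }.
Definition lcoef (f : lser) (k : int) : R :=
  match (ldeg f - k)%R with Posz m => lps f m | Negz _ => 0 end.
Definition lconst (c : R) : lser := LSer 0 (fun m => if m == 0%N then c else 0).
Definition lzero : lser := lconst 0.
Definition lz : lser := LSer 1 (fun m => if m == 0%N then 1 else 0).
Definition ladd (f g : lser) : lser :=
  let d := Num.max (ldeg f) (ldeg g) in
  LSer d (fun m => lcoef f (d - m%:Z) + lcoef g (d - m%:Z)).
Definition lopp (f : lser) : lser := LSer (ldeg f) (fun m => - lps f m).
Definition lmul (f g : lser) : lser :=
  LSer (ldeg f + ldeg g) (fun m => \sum_(i < m.+1) lps f i * lps g (m - i)%N).
Definition lsum (s : seq lser) : lser := foldr ladd lzero s.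
Definition lprod (s : seq lser) : lser := foldr lmul (lconst 1) s.
Definition llin (c : R) : lser :=
  LSer 1 (fun m => if m == 0%N then 1 else if m == 1%N then - c else 0).
(* (z - c)^{-1} = sum_{m>=0} c^m z^{-m-1}, expanded in z^{-1} *)
Definition linvlin (c : R) : lser := LSer (-1) (fun m => c ^+ m).
Definition is_const (f : lser) : Prop := forall k : int, k != 0 -> lcoef f k = 0.
End LSer.

Fixpoint idx_tuples (a : nat -> nat) (i len : nat) : seq (seq nat) :=
  match len with
  | 0 => [:: [::]]
  | len'.+1 => [seq x :: t | x <- iota 1 (a i), t <- idx_tuples a i.+1 len']
  end.

Section TD.
Variable K : fieldType.
Variable R : unitAlgType K.
Variable a : nat -> nat.
Variable p eq eqi : nat -> nat -> R.  (* p_{i,r}, e^{q_{i,r}}, e^{-q_{i,r}} *)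
Variable x1 : K.
Variable ss : nat.                (* the index s (point x_1 carries varpi_s) *)

Definition Pev (j : nat) (x : R) : R := \prod_(t <- iota 1 (a j)) (x - p j t).
Definition Prev (j r : nat) (x : R) : R :=
  \prod_(t <- iota 1 (a j) | t != r) (x - p j t).
Definition Zev (k : nat) (x : R) : R := if k == ss then x - x1%:A else 1.

(* P_j(z), 1/P_j(z-1), Z_k(z) as Laurent series *)
Definition lPoly (j : nat) : lser R := lprod [seq llin (p j t) | t <- iota 1 (a j)].
Definition lInvShift (j : nat) : lser R :=
  lprod [seq linvlin (1 + p j t) | t <- iota 1 (a j)].
Definition lZ (k : nat) : lser R := if k == ss then llin (x1%:A) else lconst 1.

Definition gD (i : nat) : lser R :=
  lmul (lPoly i) (lmul (lInvShift i.-1) (lprod [seq lZ k | k <- iota 0 i])).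

(* denominators prod_{k=i}^{j-1} P_{k,r_k}(p_{k,r_k}) ; t lists r_i..r_{j-1} *)
Definition rr (t : seq nat) (i k : nat) : nat := nth 0%N t (k - i).
Definition denD (i j : nat) (t : seq nat) : R :=
  \prod_(k <- iota i (j - i)) Prev k (rr t i k) (p k (rr t i k)).

Definition eterm (i j : nat) (t : seq nat) : lser R :=
  let num := Pev i.-1 (p i (rr t i i) - 1) *
             \prod_(k <- iota i (j.-1 - i)) Prev k (rr t i k) (p k.+1 (rr t i k.+1) - 1) in
  let zp := \prod_(k <- iota i (j - i)) Zev k (p k (rr t i k)) in
  let ex := \prod_(k <- iota i (j - i)) eq k (rr t i k) in
  lmul (lconst (num * (denD i j t)^-1))
       (lmul (linvlin (p i (rr t i i))) (lconst (zp * ex))).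

Definition fterm (j i : nat) (t : seq nat) : lser R :=
  let num := Pev j (p j.-1 (rr t i j.-1) + 1) *
             \prod_(k <- iota i.+1 (j.-1 - i)) Prev k (rr t i k) (p k.-1 (rr t i k.-1) + 1) in
  let ex := \prod_(k <- iota i (j - i)) eqi k (rr t i k) in
  lmul (lconst (num * (denD i j t)^-1))
       (lmul (linvlin (p i (rr t i i) + 1)) (lconst ex)).

Definition eD (i j : nat) : lser R :=
  if i == j then lconst 1
  else if (i < j)%N then lopp (lsum [seq eterm i j t | t <- idx_tuples a i (j - i)])
  else lzero R.
Definition fD (j i : nat) : lser R :=
  if i == j then lconst 1
  else if (i < j)%N then lsum [seq fterm j i t | t <- idx_tuples a i (j - i)]
  else lzero R.

Definition TD (al be : nat) : lser R :=
  lsum [seq lmul (fD al i) (lmul (gD i) (eD i be)) | i <- iota 1 (minn al be)].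
End TD.

(* Main.v *)
Require Import Defs.
From HB Require Import structures.
From mathcomp Require Import all_boot all_order all_algebra.
From mathcomp Require Import complex boolp.
From mathcomp Require Import zify.
Set Implicit Arguments. Unset Strict Implicit. Unset Printing Implicit Defensive.
Import Order.TTheory GRing.Theory Num.Theory.
Local Open Scope ring_scope.

(** In the Gauss decomposition T = F G E the i-th summand of an entry of T has
simple poles in z at the points p_(i,r) + 1 and p_(i-1,r) + 1 only, and the
residues of consecutive summands at p_(i,r) + 1 are opposite.  So T is
polynomial in z, and the degrees of the g_i give T = (A, Q; -P, 1) with P and Q
constant and A = z + constant.  The inverses of E and F are again explicit sums
over chains r_i, ..., r_(j-1), with the pole moved from the first to the last
node of the chain, hence T' = E^-1 ((z - x_1) G^-1) F^-1 is polynomial by the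
same cancellation, and its upper left block, being 1 + O(1/z), is 1.
From T' T = z - x_1 and the lower right block 1 of T one gets
A + Q P = z - x_1, that is F = x_1 + Q P. *)

(** * Laurent series in 1/z *)

(** The obstacle is that the e^q do not commute with the p: carrying e^(-q) past 1/(z - p) gives
    1/(z - p - 1), so a residue is only meaningful once all shift operators stand on a fixed side.
    This is why the poles of e_(i,j) at p_(i,r) meet those of the preceding factors at p_(i,r) + 1,
    and why a direct expansion of A + Q P is avoided. The degrees come from the multiplicities a_j =
    j - max(j - s, 0) - max(j - r, 0), which follow from the coordinates of the weight. They give
    deg g_i = a_i - a_(i-1) + [s < i] = [i <= r], whereas (z - x_1)/g_i has the complementary degree
    [r < i]. Hence the identity blocks of T and T' sit in opposite corners, and with these two
    blocks known the equation T' T = z - x_1 determines the upper right block of T' as -Q and then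
    the upper left block of T. Only the defining relations of the p and e^q and the invertibility of
    the differences of the p are used, so the argument runs in any algebra with such elements. *)

Section LaurentCoefficients.
Variable R : nzRingType.
Implicit Types f g h : lser R.

Lemma lcoefE f (k : int) (m : nat) : ldeg f - k = m%:Z -> lcoef f k = lps f m.
Proof. by rewrite /lcoef => ->. Qed.

Lemma lcoef_gt f (k : int) : ldeg f < k -> lcoef f k = 0.
Proof. by rewrite /lcoef; case E: (ldeg f - k) => [m|m] //; lia. Qed.

Lemma lcoef_lconst (c : R) k : lcoef (lconst c) k = if k == 0 then c else 0.
Proof.
rewrite /lcoef /=; case E: (0 - k) => [m|m]; last by rewrite ifN //; lia.
by have -> : (m == 0%N) = (k == 0) by lia.
Qed.

Lemma lcoef_lz k : lcoef (lz R) k = if k == 1 then 1 else 0.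
Proof.
rewrite /lcoef /=; case E: (1 - k) => [m|m]; last by rewrite ifN //; lia.
by have -> : (m == 0%N) = (k == 1) by lia.
Qed.

Lemma lcoef_ladd f g k : lcoef (ladd f g) k = lcoef f k + lcoef g k.
Proof.
have [le|gt] := lerP k (ldeg (ladd f g)); last first.
  have := gt; rewrite /= gt_max => /andP[gf gg].
  by rewrite !lcoef_gt // addr0.
have -> := @lcoefE (ladd f g) k `|ldeg (ladd f g) - k|%N; last by lia.
rewrite /=.
have -> : Num.max (ldeg f) (ldeg g) - (absz (Num.max (ldeg f) (ldeg g) - k)%R)%:Z = k :> int by move: le => /=; lia.
by [].
Qed.

Lemma lcoef_lopp f k : lcoef (lopp f) k = - lcoef f k.
Proof. by rewrite /lcoef /=; case: (ldeg f - k) => // _; rewrite oppr0. Qed.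

(* Any upper bounds [D], [E] of the degrees give the same Cauchy product. *)
Lemma lcoef_lmul f g (D E k : int) (N : nat) :
  (forall j, D < j -> lcoef f j = 0) -> (forall j, E < j -> lcoef g j = 0) ->
  D + E - k = N%:Z ->
  lcoef (lmul f g) k = \sum_(i < N.+1) lcoef f (D - i%:Z) * lcoef g (E - (N - i)%N%:Z).
Proof.
move=> hD hE hN.
pose F (j : int) := lcoef f j * lcoef g (k - j).
have F0 j : D < j \/ E < k - j -> F j = 0.
  by rewrite /F => -[h|h]; [rewrite hD // mul0r|rewrite (hE (k - j)) // mulr0].
have F0' j : ldeg f < j \/ ldeg g < k - j -> F j = 0.
  by rewrite /F => -[h|h]; [rewrite (lcoef_gt h) mul0r|rewrite (@lcoef_gt g) // mulr0].
(* Both Cauchy sums run over a window containing the support of [F]. Each is extended by zeros to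
   the common window from -B to B. *)
have key (D1 E1 : int) (N1 : nat) : D1 + E1 - k = N1%:Z ->
    (forall j, D1 < j \/ E1 < k - j -> F j = 0) ->
  forall B : nat, D1 <= B%:Z -> k - E1 >= - B%:Z ->
  \sum_(i < N1.+1) F (D1 - i%:Z) = \sum_(i < (B + B).+1) F (B%:Z - i%:Z).
  move=> h1 h2 B hB hB'.
  rewrite -(big_mkord xpredT (fun i => F (D1 - i%:Z))).
  rewrite -(big_mkord xpredT (fun i => F (B%:Z - i%:Z))).
  have [u hu] : exists u : nat, B%:Z - D1 = u%:Z by exists `|B%:Z - D1|%N; lia.
  rewrite (@big_cat_nat _ _ _ u 0 (B + B).+1) //=; last by lia.
  rewrite (@big_cat_nat _ _ _ (u + N1.+1) u (B + B).+1) //=; try lia.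
  rewrite [X in X + _]big1_seq ?add0r; last first.
    by move=> i /andP[_]; rewrite mem_index_iota => hi; apply: h2; left; lia.
  rewrite [X in _ + X]big1_seq ?addr0; last first.
    by move=> i /andP[_]; rewrite mem_index_iota => hi; apply: h2; right; lia.
  rewrite [RHS](_ : _ = \sum_(0 + u <= i < u + N1.+1) F (B%:Z - i%:Z)) // big_addn addKn.
  apply: eq_bigr => i _; congr F; lia.
have e1 i : (i < N.+1)%N -> lcoef f (D - i%:Z) * lcoef g (E - (N - i)%N%:Z) = F (D - i%:Z).
  by move=> hi; rewrite /F; congr (_ * lcoef g _); lia.
under eq_bigr => i _ do rewrite e1 //.
have [le|gt] := lerP k (ldeg f + ldeg g); last first.
  rewrite lcoef_gt //; apply/esym/big1 => i _.
  have [?|?] := ltrP (ldeg f) (D - i%:Z); first by apply: F0'; left.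
  by apply: F0'; right; lia.
pose N0 := absz (ldeg f + ldeg g - k)%R.
rewrite (@lcoefE (lmul f g) k N0) /=; last by rewrite /N0; lia.
pose B := (absz D + absz (k - E)%R + absz (ldeg f) + absz (k - ldeg g)%R)%N.
rewrite (key D E N hN F0 B); try by rewrite /B; lia.
rewrite -(key (ldeg f) (ldeg g) N0 _ F0' B); try by rewrite /N0 /B; lia.
apply: eq_bigr => -[i hi] _ /=; rewrite /F.
congr (_ * _); first by apply/esym/lcoefE; lia.
by apply/esym/lcoefE; rewrite /N0; rewrite /N0 in hi; lia.
Qed.

Lemma lcoef_lmul_gt f g (D E k : int) :
  (forall j, D < j -> lcoef f j = 0) -> (forall j, E < j -> lcoef g j = 0) ->
  D + E < k -> lcoef (lmul f g) k = 0.
Proof.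
move=> hD hE hk.
have [le|gt] := lerP k (ldeg f + ldeg g); last by rewrite lcoef_gt.
rewrite (@lcoef_lmul f g (ldeg f) (ldeg g) k (absz (ldeg f + ldeg g - k)%R));
  [|exact: lcoef_gt|exact: lcoef_gt|lia].
apply: big1 => -[i hi] _ /=.
have [?|?] := ltrP D (ldeg f - i%:Z); first by rewrite hD // mul0r.
by rewrite (hE) ?mulr0 //; lia.
Qed.

Lemma eq_lmul f f' g g' : lcoef f =1 lcoef f' -> lcoef g =1 lcoef g' ->
  lcoef (lmul f g) =1 lcoef (lmul f' g').
Proof.
move=> ef eg k.
have [le|gt] := lerP k (ldeg f + ldeg g).
  rewrite !(@lcoef_lmul _ _ (ldeg f) (ldeg g) k (absz (ldeg f + ldeg g - k)%R)); try lia;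
    try exact: lcoef_gt; try by move=> j hj; rewrite -?ef -?eg lcoef_gt.
  by apply: eq_bigr => i _; rewrite ef eg.
rewrite lcoef_gt //; apply/esym.
by apply: (@lcoef_lmul_gt _ _ (ldeg f) (ldeg g)) => // j hj; rewrite -?ef -?eg lcoef_gt.
Qed.

Lemma lmulA f g h : lmul f (lmul g h) = lmul (lmul f g) h.
Proof.
rewrite /lmul /= addrA; congr LSer; apply: funext => m.
pose G j k := lps f j * (lps g (m - j - k)%N * lps h k).
transitivity (\sum_(j < m.+1) \sum_(k < m.+1 | (k <= m - j)%N) G j k).
  apply: eq_bigr => /= -[j hj] _ /=; rewrite big_distrr /=.
  rewrite (reindex_inj rev_ord_inj) /=.
  rewrite (big_ord_narrow_leq (leq_subr j m)) /=.
  apply: eq_bigr => -[k hk] _ /=; rewrite /G.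
  have -> : ((m - j).+1 - k.+1 = m - j - k)%N by lia.
  by have -> : (m - j - (m - j - k) = k)%N by lia.
rewrite (exchange_big_dep predT) //= (reindex_inj rev_ord_inj) /=.
apply: eq_bigr => -[k hk] _ /=.
transitivity (\sum_(j < m.+1 | (j <= k)%N) G j (m - k)%N).
  apply: eq_big => [[j hj]|[j hj] _] /=; first by rewrite subSS; lia.
  by rewrite subSS.
have km : (k <= m)%N by []. rewrite (big_ord_narrow_leq km) /=.
rewrite big_distrl /=; apply: eq_bigr => -[j hj] _ /=.
rewrite /G mulrA; congr (_ * lps g _ * _); lia.
Qed.
End LaurentCoefficients.

(** * The ring of Laurent series in 1/z with central z *)

Section LaurentRing.
Variable R : nzRingType.

(* Series are identified with their coefficient functions, so that [lser]s with
   the same coefficients become equal and form a ring. *)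
Definition is_laurent (c : int -> R) : bool := `[< exists f : lser R, lcoef f = c >].

Record laurent := Laurent { lval :> int -> R; lvalP : is_laurent lval }.
HB.instance Definition _ := [isSub for lval].
HB.instance Definition _ := [Choice of laurent by <:].

Fact laurent_of_subproof (f : lser R) : is_laurent (lcoef f).
Proof. by apply/asboolP; exists f. Qed.
Definition laurent_of f : laurent := Laurent (laurent_of_subproof f).
Definition laurent_repr (x : laurent) : lser R := projT1 (cid (elimT (asboolP _) (lvalP x))).

Lemma laurent_reprK x : laurent_of (laurent_repr x) = x.
Proof. by apply: val_inj; rewrite /= /laurent_repr; case: cid. Qed.

Lemma laurentP (x y : laurent) : x =1 y -> x = y.
Proof. by move=> e; apply/val_inj/funext. Qed.

Definition laurent_add x y := laurent_of (ladd (laurent_repr x) (laurent_repr y)).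
Definition laurent_opp x := laurent_of (lopp (laurent_repr x)).
Definition laurent_mul x y := laurent_of (lmul (laurent_repr x) (laurent_repr y)).
Arguments laurent_add : simpl never.
Arguments laurent_opp : simpl never.
Arguments laurent_mul : simpl never.

Lemma lcoef_repr x : lcoef (laurent_repr x) =1 x.
Proof. by move=> k; rewrite -[in RHS](laurent_reprK x). Qed.

Lemma laurent_addE x y k : laurent_add x y k = x k + y k.
Proof. by rewrite /laurent_add /= lcoef_ladd !lcoef_repr. Qed.

(** The product does not depend on the representatives chosen by [laurent_repr], since by [eq_lmul]
    it only sees coefficients. *)
Lemma laurent_ofM f g :
  laurent_mul (laurent_of f) (laurent_of g) = laurent_of (lmul f g).
Proof. by apply: laurentP => k; apply: eq_lmul => j; rewrite lcoef_repr. Qed.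

Fact laurent_addA : associative laurent_add.
Proof. by move=> x y z; apply: laurentP => k; rewrite !laurent_addE addrA. Qed.
Fact laurent_addC : commutative laurent_add.
Proof. by move=> x y; apply: laurentP => k; rewrite !laurent_addE addrC. Qed.
Fact laurent_add0 : left_id (laurent_of (lzero R)) laurent_add.
Proof. by move=> x; apply: laurentP => k; rewrite laurent_addE /= lcoef_lconst if_same add0r. Qed.
Fact laurent_addN : left_inverse (laurent_of (lzero R)) laurent_opp laurent_add.
Proof.
move=> x; apply: laurentP => k.
by rewrite laurent_addE /laurent_opp /= lcoef_lopp lcoef_repr addNr lcoef_lconst if_same.
Qed.

HB.instance Definition _ := GRing.isZmodule.Build laurent
  laurent_addA laurent_addC laurent_add0 laurent_addN.

Lemma laurentD (x y : laurent) k : (x + y) k = x k + y k.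
Proof. exact: laurent_addE. Qed.

Lemma laurentM_coef (x y : laurent) (D E k : int) (N : nat) :
  (forall j, D < j -> x j = 0) -> (forall j, E < j -> y j = 0) ->
  D + E - k = N%:Z ->
  laurent_mul x y k = \sum_(i < N.+1) x (D - i%:Z) * y (E - (N - i)%N%:Z).
Proof.
move=> hD hE hk; rewrite /laurent_mul /= (@lcoef_lmul _ _ _ D E k N) //.
- by apply: eq_bigr => i _; rewrite !lcoef_repr.
- by move=> j; rewrite lcoef_repr; apply: hD.
- by move=> j; rewrite lcoef_repr; apply: hE.
Qed.

Lemma laurentM_coef_gt (x y : laurent) (D E k : int) :
  (forall j, D < j -> x j = 0) -> (forall j, E < j -> y j = 0) ->
  D + E < k -> laurent_mul x y k = 0.
Proof.
move=> hD hE hk; apply: (@lcoef_lmul_gt _ _ _ D E) => // j.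
- by rewrite lcoef_repr; apply: hD.
- by rewrite lcoef_repr; apply: hE.
Qed.

Lemma laurent_bound (x : laurent) : exists D : nat, forall j, D%:Z < j -> x j = 0.
Proof.
exists (absz (ldeg (laurent_repr x))) => j hj.
by rewrite -lcoef_repr lcoef_gt //; lia.
Qed.

Lemma laurent_bound2 (x y : laurent) :
  exists D : nat, (forall j, D%:Z < j -> x j = 0) /\ (forall j, D%:Z < j -> y j = 0).
Proof.
have [D hD] := laurent_bound x; have [E hE] := laurent_bound y.
by exists (D + E)%N; split=> j hj; [apply: hD|apply: hE]; lia.
Qed.

Fact laurent_mulA : associative laurent_mul.
Proof.
move=> x y z; rewrite -(laurent_reprK x) -(laurent_reprK y) -(laurent_reprK z).
by rewrite !laurent_ofM lmulA.
Qed.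

Lemma lcoef_lmulC (c : R) f k : lcoef (lmul (lconst c) f) k = c * lcoef f k.
Proof.
have [le|gt] := lerP k (ldeg f); last first.
  by rewrite (lcoef_gt gt) lcoef_gt ?mulr0 //= add0r.
rewrite (@lcoef_lmul _ _ _ 0 (ldeg f) k (absz (ldeg f - k)%R));
  [|by move=> j; apply: (@lcoef_gt _ (lconst c))|by move=> j; apply: lcoef_gt|lia].
rewrite big_ord_recl big1 ?addr0 => [|i _]; last first.
  rewrite lcoef_lconst (_ : (_ == 0) = false) ?mul0r //; rewrite /= /bump; lia.
by rewrite lcoef_lconst /= subn0; congr (_ * lcoef f _); lia.
Qed.

Lemma lcoef_lmulCr (c : R) f k : lcoef (lmul f (lconst c)) k = lcoef f k * c.
Proof.
have [le|gt] := lerP k (ldeg f); last first.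
  by rewrite (lcoef_gt gt) lcoef_gt ?mul0r //= addr0.
rewrite (@lcoef_lmul _ _ _ (ldeg f) 0 k (absz (ldeg f - k)%R));
  [|by move=> j; apply: lcoef_gt|by move=> j; apply: (@lcoef_gt _ (lconst c))|lia].
rewrite big_ord_recr big1 => [|[i hi] _ /=]; last first.
  by rewrite lcoef_lconst (_ : (_ == 0) = false) ?mulr0 //; lia.
by rewrite lcoef_lconst /= subnn /= add0r; congr (lcoef f _ * _); lia.
Qed.

Fact laurent_mul1 : left_id (laurent_of (lconst 1)) laurent_mul.
Proof.
move=> x; rewrite -(laurent_reprK x) laurent_ofM; apply: laurentP => k /=.
by rewrite lcoef_lmulC mul1r.
Qed.
Fact laurent_mulr1 : right_id (laurent_of (lconst 1)) laurent_mul.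
Proof.
move=> x; rewrite -(laurent_reprK x) laurent_ofM; apply: laurentP => k /=.
by rewrite lcoef_lmulCr mulr1.
Qed.

Fact laurent_mulDl : left_distributive laurent_mul +%R.
Proof.
move=> x y z; apply: laurentP => k; rewrite laurentD.
have [D [hx hy]] := laurent_bound2 x y; have [E hz] := laurent_bound z.
have hxy j : D%:Z < j -> (x + y) j = 0.
  by move=> hj; rewrite laurentD hx // hy // addr0.
have [le|gt] := lerP k (D%:Z + E%:Z).
  rewrite !(@laurentM_coef _ _ D%:Z E%:Z k (absz (D%:Z + E%:Z - k)%R)) //; try lia.
  rewrite -big_split; apply: eq_bigr => i _.
  by rewrite laurentD mulrDl.
by rewrite !(@laurentM_coef_gt _ _ D%:Z E%:Z) ?addr0.
Qed.

Fact laurent_mulDr : right_distributive laurent_mul +%R.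
Proof.
move=> z x y; apply: laurentP => k; rewrite laurentD.
have [D [hx hy]] := laurent_bound2 x y; have [E hz] := laurent_bound z.
have hxy j : D%:Z < j -> (x + y) j = 0.
  by move=> hj; rewrite laurentD hx // hy // addr0.
have [le|gt] := lerP k (E%:Z + D%:Z).
  rewrite !(@laurentM_coef _ _ E%:Z D%:Z k (absz (E%:Z + D%:Z - k)%R)) //; try lia.
  rewrite -big_split; apply: eq_bigr => i _.
  by rewrite laurentD mulrDr.
by rewrite !(@laurentM_coef_gt _ _ E%:Z D%:Z) ?addr0.
Qed.

Fact laurent_1neq0 : laurent_of (lconst 1) != 0.
Proof.
apply/eqP => /(congr1 (fun x : laurent => x 0)) /=.
by rewrite !lcoef_lconst /=; apply/eqP/oner_neq0.
Qed.

HB.instance Definition _ := GRing.Zmodule_isNzRing.Build laurent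
  laurent_mulA laurent_mul1 laurent_mulr1 laurent_mulDl laurent_mulDr laurent_1neq0.

Implicit Types (x y : laurent) (c : R).

Lemma laurentN x k : (- x) k = - x k.
Proof. by rewrite [LHS]/(laurent_opp x k) /laurent_opp /= lcoef_lopp lcoef_repr. Qed.
Lemma laurent0 k : (0 : laurent) k = 0.
Proof. by rewrite /= lcoef_lconst if_same. Qed.
Lemma laurent_sum (I : Type) (s : seq I) (P : pred I) (F : I -> laurent) k :
  (\sum_(i <- s | P i) F i) k = \sum_(i <- s | P i) F i k.
Proof.
elim/big_rec2 : _ => [|i u v _ <-]; first exact: laurent0.
exact: laurentD.
Qed.

Lemma laurent_of_add f g : laurent_of (ladd f g) = laurent_of f + laurent_of g.
Proof. by apply: laurentP => k; rewrite laurentD /= lcoef_ladd. Qed.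
Lemma laurent_of_opp f : laurent_of (lopp f) = - laurent_of f.
Proof. by apply: laurentP => k; rewrite laurentN /= lcoef_lopp. Qed.
Lemma laurent_of_mul f g : laurent_of (lmul f g) = laurent_of f * laurent_of g.
Proof. by rewrite -laurent_ofM. Qed.
Lemma laurent_of_sum s : laurent_of (lsum s) = \sum_(f <- s) laurent_of f.
Proof. by elim: s => [|f s IH]; rewrite ?big_nil // big_cons /= laurent_of_add IH. Qed.
Lemma laurent_of_prod s : laurent_of (lprod s) = \prod_(f <- s) laurent_of f.
Proof. by elim: s => [|f s IH]; rewrite ?big_nil // big_cons /= laurent_of_mul IH. Qed.

Definition lC c : laurent := laurent_of (lconst c).
Definition lZ1 : laurent := laurent_of (lz R).
Definition linv c : laurent := laurent_of (linvlin c).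
Arguments lval : simpl never.

Lemma lC_coef c k : lC c k = if k == 0 then c else 0.
Proof. exact: lcoef_lconst. Qed.

Fact lC_additive : zmod_morphism lC.
Proof.
by move=> a b; apply: laurentP => k; rewrite laurentD laurentN !lC_coef; case: eqP; rewrite ?subr0.
Qed.
Fact lC_multiplicative : monoid_morphism lC.
Proof.
split=> // a b; apply: laurentP => k; rewrite -laurent_of_mul /lval /= lcoef_lmulC !lcoef_lconst.
by case: ifP; rewrite ?mulr0.
Qed.
HB.instance Definition _ := GRing.isZmodMorphism.Build R laurent lC lC_additive.
HB.instance Definition _ := GRing.isMonoidMorphism.Build R laurent lC lC_multiplicative.

Lemma lC1 : lC 1 = 1. Proof. exact: rmorph1. Qed.
Lemma lCM (a b : R) : lC (a * b) = lC a * lC b. Proof. exact: rmorphM. Qed.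

Lemma lCM_coef c x k : (lC c * x) k = c * x k.
Proof. by rewrite -[in LHS](laurent_reprK x) -laurent_of_mul /lval /= lcoef_lmulC lcoef_repr. Qed.
Lemma lMC_coef c x k : (x * lC c) k = x k * c.
Proof. by rewrite -[in LHS](laurent_reprK x) -laurent_of_mul /lval /= lcoef_lmulCr lcoef_repr. Qed.

Lemma lZ1_coef k : lZ1 k = if k == 1 then 1 else 0.
Proof. exact: lcoef_lz. Qed.

Lemma lZ1M_coef x k : (lZ1 * x) k = x (k - 1).
Proof.
have [D hD] := laurent_bound x.
have h1 j : 1 < j -> lZ1 j = 0 by move=> hj; rewrite lZ1_coef ifN //; lia.
have [le|gt] := lerP k (1 + D%:Z); last first.
  by rewrite [LHS](@laurentM_coef_gt _ _ 1 D%:Z) // hD //; lia.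
rewrite [LHS](@laurentM_coef _ _ 1 D%:Z k (absz (1 + D%:Z - k)%R)) //; last by lia.
rewrite big_ord_recl big1 ?addr0 => [|[i hi] _]; last first.
  by rewrite lZ1_coef (_ : (_ == 1) = false) ?mul0r //=; rewrite /bump; lia.
by rewrite lZ1_coef /= mul1r; congr (x _); lia.
Qed.

Lemma lMZ1_coef x k : (x * lZ1) k = x (k - 1).
Proof.
have [D hD] := laurent_bound x.
have h1 j : 1 < j -> lZ1 j = 0 by move=> hj; rewrite lZ1_coef ifN //; lia.
have [le|gt] := lerP k (D%:Z + 1); last first.
  by rewrite [LHS](@laurentM_coef_gt _ _ D%:Z 1) // hD //; lia.
rewrite [LHS](@laurentM_coef _ _ D%:Z 1 k (absz (D%:Z + 1 - k)%R)) //; last by lia.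
rewrite big_ord_recr big1 => [|[i hi] _ /=]; last first.
  by rewrite lZ1_coef (_ : (_ == 1) = false) ?mulr0 //; lia.
by rewrite /= lZ1_coef subnn /= mulr1 add0r; congr (x _); lia.
Qed.

Lemma lZ1_comm x : GRing.comm lZ1 x.
Proof. by apply: laurentP => k; rewrite lZ1M_coef lMZ1_coef. Qed.

Lemma laurent_of_lin c : laurent_of (llin c) = lZ1 - lC c.
Proof.
apply: laurentP => k; rewrite laurentD laurentN lC_coef lZ1_coef /lval /laurent_of /lcoef /=.
case E: (1 - k) => [m|m]; last by rewrite !ifN ?subr0 //; lia.
have -> : (m == 0%N) = (k == 1) by lia.
have -> : (m == 1%N) = (k == 0) by lia.
by case: eqVneq => [->|_]; rewrite ?subr0 // sub0r; case: ifP; rewrite ?oppr0.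
Qed.

Lemma linv_coef c k : linv c k = if k <= - 1 then c ^+ absz (k + 1)%R else 0.
Proof.
rewrite /lval /= /lcoef /=; case E: (- 1 - k) => [m|m]; last by rewrite ifN //; lia.
by rewrite ifT; [congr (c ^+ _)|]; lia.
Qed.

Lemma linvVl c : linv c * (lZ1 - lC c) = 1.
Proof.
apply: laurentP => k; rewrite mulrBr laurentD laurentN lMC_coef lMZ1_coef.
rewrite !linv_coef -lC1 lC_coef.
case: (ltrgtP k 0) => hk.
- rewrite !ifT; try lia.
  by rewrite -exprSr subrK; apply/eqP; rewrite subr_eq0; apply/eqP; congr (c ^+ _); lia.
- by rewrite !ifF ?mul0r ?subr0 //; lia.
- by rewrite hk /= expr0 mul0r subr0.
Qed.

Lemma linv_comm c : GRing.comm (linv c) (lC c).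
Proof.
apply: laurentP => k; rewrite lCM_coef lMC_coef linv_coef.
by case: ifP; rewrite ?mul0r ?mulr0 // => _; rewrite -exprS -exprSr.
Qed.

Lemma linvVr c : (lZ1 - lC c) * linv c = 1.
Proof.
by rewrite -(linvVl c) mulrBl mulrBr lZ1_comm linv_comm.
Qed.

(** The mechanism of all pole shifts: u = e^(-q) or e^q carries a pole at p to p + 1 or p - 1. It is
    the relation (z - c') u = u (z - c) with both linear factors inverted. *)
Lemma linv_intertwine (u c c' : R) : u * c = c' * u -> lC u * linv c = linv c' * lC u.
Proof.
move=> h; rewrite -[LHS]mul1r -(linvVl c') -!mulrA; congr (_ * _).
rewrite mulrA -[RHS]mulr1 -(linvVr c) [RHS]mulrA; congr (_ * _).
by rewrite mulrBl mulrBr -lZ1_comm -!rmorphM h.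
Qed.

(** * Degree bounds and monic series *)

Definition ldeg_le (d : int) (x : laurent) := forall k, d < k -> x k = 0.
Definition lmonic (d : int) (x : laurent) := ldeg_le d x /\ x d = 1.

Lemma ldeg_leM d e x y : ldeg_le d x -> ldeg_le e y -> ldeg_le (d + e) (x * y).
Proof. by move=> hx hy k; apply: laurentM_coef_gt. Qed.
Lemma lmonicM d e x y : lmonic d x -> lmonic e y -> lmonic (d + e) (x * y).
Proof.
move=> [hx x1] [hy y1]; split; first exact: ldeg_leM.
rewrite [LHS](@laurentM_coef _ _ d e (d + e) 0) ?subrr //.
by rewrite big_ord_recl big_ord0 addr0 !subr0 x1 y1 mulr1.
Qed.
Lemma ldeg_leW d e x : d <= e -> ldeg_le d x -> ldeg_le e x.
Proof. by move=> de h k hk; apply: h; lia. Qed.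
Lemma ldeg_leD d x y : ldeg_le d x -> ldeg_le d y -> ldeg_le d (x + y).
Proof. by move=> hx hy k hk; rewrite laurentD hx // hy // addr0. Qed.
Lemma ldeg_leN d x : ldeg_le d x -> ldeg_le d (- x).
Proof. by move=> hx k hk; rewrite laurentN hx // oppr0. Qed.
Lemma ldeg_le_sum d (I : eqType) (s : seq I) (F : I -> laurent) :
  (forall i, i \in s -> ldeg_le d (F i)) -> ldeg_le d (\sum_(i <- s) F i).
Proof. by move=> h k hk; rewrite laurent_sum big1_seq // => i /andP[_ /h]; apply. Qed.
Lemma ldeg_lC c : ldeg_le 0 (lC c).
Proof. by move=> k hk; rewrite lC_coef ifN //; lia. Qed.
Lemma lmonic1 : lmonic 0 1.
Proof. by split; [exact: ldeg_lC|rewrite -lC1 lC_coef]. Qed.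
Lemma lmonic_linv c : lmonic (- 1) (linv c).
Proof. by split=> [k hk|]; rewrite linv_coef ?ifN ?ifT ?expr0 //; lia. Qed.
Lemma lmonic_lin c : lmonic 1 (lZ1 - lC c).
Proof.
split=> [k hk|]; rewrite laurentD laurentN lC_coef lZ1_coef ?subr0 //.
by rewrite !ifN ?subr0 //; lia.
Qed.
Lemma lmonic_prod (I : Type) (d : int) (s : seq I) (F : I -> laurent) :
  (forall i, lmonic d (F i)) -> lmonic (d *+ size s) (\prod_(i <- s) F i).
Proof.
move=> h; elim: s => [|i s IH]; first by rewrite big_nil; exact: lmonic1.
by rewrite big_cons mulrS; apply: lmonicM.
Qed.

(** Substituting z for ['X] is a ring morphism although [R] is not commutative, because z is
    central. *)
Definition lpoly : {poly R} -> laurent := horner_morph (fun c : R => lZ1_comm (lC c)).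
HB.instance Definition _ := GRing.RMorphism.on lpoly.

Lemma lpolyC c : lpoly c%:P = lC c. Proof. exact: horner_morphC. Qed.
Lemma lpolyX : lpoly 'X = lZ1. Proof. exact: horner_morphX. Qed.

Lemma lpoly_coef p k : lpoly p k = if k is Posz i then p`_i else 0.
Proof.
elim/poly_ind: p k => [|p c IH] k.
  by rewrite rmorph0 laurent0; case: k => // i; rewrite coef0.
rewrite rmorphD rmorphM /= lpolyC lpolyX laurentD lMZ1_coef lC_coef IH.
case: k => [[|i]|i].
- by rewrite coefD coefMX coefC.
- have -> : Posz i.+1 - 1 = Posz i by lia.
  by rewrite coefD coefMX coefC /= addr0.
- have -> : Negz i - 1%:Z = Negz i.+1 by lia.
  by rewrite addr0.
Qed.

(** This is right division by ['X - c%:P]. Evaluation writes coefficients to the left of powers of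
    c, so the remainder is [p.[c]] when the resolvent stands on the right. *)
Lemma lpoly_factor (p : {poly R}) c :
  exists q, lpoly p * linv c = lpoly q + lC p.[c] * linv c.
Proof.
have : root (p - p.[c]%:P) c by rewrite /root hornerD hornerN hornerC subrr.
move/factor_theorem => [q hq]; exists q.
have -> : p = q * ('X - c%:P) + p.[c]%:P by rewrite -hq subrK.
rewrite rmorphD rmorphM rmorphB /= lpolyX !lpolyC mulrDl -mulrA linvVr mulr1.
congr (_ + lC _ * _).
by rewrite hornerD hornerC hornerM_comm ?hornerD ?hornerN ?hornerC ?hornerX ?subrr ?mulr0 ?add0r //
   /comm_poly hornerXsubC subrr mulr0 mul0r.
Qed.

End LaurentRing.
Arguments lC {R}.

(** * Partial fractions with commuting poles *)

Section Commutation.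
Variable R : nzRingType.
Implicit Types x y z : R.

Lemma comm_prod_seq (I : eqType) (s : seq I) (P : pred I) (F : I -> R) x :
  (forall i, i \in s -> P i -> GRing.comm x (F i)) ->
  GRing.comm x (\prod_(i <- s | P i) F i).
Proof.
move=> h; rewrite big_seq_cond; apply: commr_prod => i /andP[]; exact: h.
Qed.

Lemma comm_sum_seq (I : eqType) (s : seq I) (P : pred I) (F : I -> R) x :
  (forall i, i \in s -> P i -> GRing.comm x (F i)) ->
  GRing.comm x (\sum_(i <- s | P i) F i).
Proof.
move=> h; rewrite big_seq_cond; apply: commr_sum => i /andP[]; exact: h.
Qed.

Lemma comm_inverse x y z : y * z = 1 -> z * y = 1 -> GRing.comm x y -> GRing.comm x z.
Proof.
move=> yz zy xy; rewrite /GRing.comm -[LHS]mul1r -zy -!mulrA [y * (x * z)]mulrA -xy.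
by rewrite -mulrA yz mulr1.
Qed.

Lemma prod_comm_D1 (I : eqType) (s : seq I) (F : I -> R) t :
  uniq s -> t \in s -> (forall i, i \in s -> GRing.comm (F t) (F i)) ->
  \prod_(i <- s) F i = F t * \prod_(i <- s | i != t) F i.
Proof.
elim: s => [|i s IH] //= /andP[nis us]; rewrite inE => /orP[/eqP ti|ts] hc.
  rewrite ti !big_cons eqxx /=; congr (_ * _).
  rewrite [LHS]big_seq [RHS]big_seq_cond; apply: eq_bigl => j.
  by case js: (j \in s) => //=; apply/esym; apply: contraNneq nis => <-.
have it : i != t by apply: contraNneq nis => ->.
rewrite !big_cons it IH //; last by move=> j js; apply: hc; rewrite inE js orbT.
by rewrite !mulrA -(hc i) ?mem_head.
Qed.
End Commutation.

Section PartialFractions.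
Variable R : unitRingType.

Lemma prodV_comm (I : eqType) (s : seq I) (F : I -> R) :
  (forall i, i \in s -> F i \is a GRing.unit) ->
  (forall i j, i \in s -> j \in s -> GRing.comm (F i) (F j)) ->
  (\prod_(i <- s) F i)^-1 = \prod_(i <- s) (F i)^-1.
Proof.
elim: s => [|i s IH] hu hc; first by rewrite !big_nil invr1.
have is_ : i \in i :: s by rewrite mem_head.
have ins j : j \in s -> j \in i :: s by rewrite inE orbC => ->.
have hp : \prod_(j <- s) F j \is a GRing.unit.
  by rewrite big_seq; apply: rpred_prod => j js; apply: hu; apply: ins.
rewrite !big_cons invrM ?hu // IH; [|by move=> j /ins /hu|by move=> j k /ins hj /ins; apply: hc].
apply: commr_sym; apply: comm_prod_seq => j js _.
by apply/commrV/commr_sym/commrV/hc => //; apply: ins.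
Qed.

Variable c : nat -> R.

(* For [z] with inverses [iv t] of [z - c t], this is
   P(x)/P(z) = 1 - (z - x) sum_t P_t(x) / (P_t(c_t) (z - c_t)), P(x) = prod_t (x - c_t). *)
Lemma partial_fractions_eval (l : seq nat) (x : R) :
  uniq l ->
  (forall t s, t \in l -> s \in l -> GRing.comm (c t) (c s)) ->
  (forall t s, t \in l -> s \in l -> t != s -> c t - c s \is a GRing.unit) ->
  (forall t, t \in l -> GRing.comm x (c t)) ->
  forall (A : nzRingType) (f : {rmorphism R -> A}) (z : A) (iv : nat -> A),
  GRing.comm z (f x) -> (forall t, t \in l -> GRing.comm z (f (c t))) ->
  (forall t, t \in l -> iv t * (z - f (c t)) = 1) ->
  (forall t, t \in l -> (z - f (c t)) * iv t = 1) ->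
  (\prod_(t <- l) iv t) * f (\prod_(t <- l) (x - c t)) =
  1 - \sum_(t <- l) iv t * f ((\prod_(s <- l | s != t) (c t - c s))^-1 *
                             \prod_(s <- l | s != t) (x - c s)) * (z - f x).
Proof.
elim: l => [|t0 l IH] ul hc hu hx A f z iv zx zc ivl ivr.
  by rewrite !big_nil rmorph1 mulr1 subr0.
have /andP[t0l ul'] := ul.
have in0 : t0 \in t0 :: l by rewrite mem_head.
have ins t : t \in l -> t \in t0 :: l by rewrite inE orbC => ->.
have neq t : t \in l -> t0 != t by move=> tl; apply: contraNneq t0l => ->.
have hc' t s : t \in l -> s \in l -> GRing.comm (c t) (c s) by move=> /ins ? /ins; apply: hc.
have hu' t s : t \in l -> s \in l -> t != s -> c t - c s \is a GRing.unit.
  by move=> /ins ? /ins; apply: hu.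
have hx' t : t \in l -> GRing.comm x (c t) by move=> /ins; apply: hx.
have zc' t : t \in l -> GRing.comm z (f (c t)) by move=> /ins; apply: zc.
have ivl' t : t \in l -> iv t * (z - f (c t)) = 1 by move=> /ins; apply: ivl.
have ivr' t : t \in l -> (z - f (c t)) * iv t = 1 by move=> /ins; apply: ivr.
have commf a b : GRing.comm a b -> GRing.comm (f a) (f b).
  by move=> ab; rewrite /GRing.comm -!rmorphM ab.
pose w t := (\prod_(s <- l | s != t) (c t - c s))^-1 * \prod_(s <- l | s != t) (x - c s).
pose g t := (c t - c t0)^-1.
have gu t : t \in l -> c t - c t0 \is a GRing.unit.
  by move=> tl; apply: hu => //; [apply: ins|rewrite eq_sym neq].
have hdu t : t \in l -> \prod_(s <- l | s != t) (c t - c s) \is a GRing.unit.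
  move=> tl; rewrite big_seq_cond; apply: rpred_prod => s /andP[sl st].
  by apply: hu' => //; rewrite eq_sym.
have wE t : t \in l -> (\prod_(s <- t0 :: l | s != t) (c t - c s))^-1 *
    \prod_(s <- t0 :: l | s != t) (x - c s) = g t * (x - c t0) * w t.
  move=> tl; rewrite !big_cons neq // invrM ?hdu ?gu // /g /w -!mulrA.
  have h1 : GRing.comm (c t - c t0)^-1 (\prod_(s <- l | s != t) (c t - c s))^-1.
    apply/commr_sym/commrV/commr_sym/commrV/comm_prod_seq => s sl st.
    by apply: commrB; apply: commr_sym; apply: commrB; apply: hc => //; apply: ins.
  have h2 : GRing.comm (x - c t0) (\prod_(s <- l | s != t) (c t - c s))^-1.
    apply/commrV/comm_prod_seq => s sl st.
    apply: commrB; apply: commr_sym; apply: commrB;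
      try (by apply: hc => //; apply: ins); by apply: commr_sym; apply: hx; apply: ins.
  by rewrite [Y in _ = _ * Y]mulrA h2 -[Y in _ = _ * Y]mulrA !mulrA h1.
have head0 : \prod_(s <- t0 :: l | s != t0) (c t0 - c s) = \prod_(s <- l) (c t0 - c s).
  by rewrite big_cons eqxx /= big_seq_cond [RHS]big_seq; apply: eq_bigl => s;
     case sl: (s \in l) => //=; rewrite eq_sym neq.
have head1 : \prod_(s <- t0 :: l | s != t0) (x - c s) = \prod_(s <- l) (x - c s).
  by rewrite big_cons eqxx /= big_seq_cond [RHS]big_seq; apply: eq_bigl => s;
     case sl: (s \in l) => //=; rewrite eq_sym neq.
have gN t : t \in l -> (c t0 - c t)^-1 = - g t by move=> _; rewrite /g -invrN opprB.
(* The coefficient at the new pole [c t0] comes from the induction hypothesis read in [R] itself,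
   with z := [c t0]. For this the statement quantifies over the target ring [A] and the morphism
   [f]. *)
have resid : (\prod_(s <- l) (c t0 - c s))^-1 * \prod_(s <- l) (x - c s) =
    1 - \sum_(t <- l) g t * (x - c t0) * w t.
  rewrite prodV_comm; first last.
  - by move=> t s tl sl; apply: commrB; apply: commr_sym; apply: commrB; apply: hc => //; apply: ins.
  - by move=> t tl; apply: hu => //; [apply: ins|apply: neq].
  have := IH ul' hc' hu' hx' R idfun (c t0) (fun t => (c t0 - c t)^-1) _ _ _ _.
  rewrite /= => ->; first last.
  - by move=> t tl; rewrite mulrV //; apply: hu; [|apply: ins|apply: neq].
  - by move=> t tl; rewrite mulVr //; apply: hu; [|apply: ins|apply: neq].
  - by move=> t tl; apply: hc => //; apply: ins.
  - by apply/commr_sym/hx.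
  congr (1 - _); rewrite big_seq [RHS]big_seq; apply: eq_bigr => t tl.
  rewrite -/(w t) gN // -[x - c t0]opprB mulrN !mulNr -!mulrA; congr (- (_ * _)).
  rewrite mulrA; apply/esym.
  suff: GRing.comm (c t0 - x) (w t) by [].
  rewrite /w; apply: commrM.
    apply/commrV/comm_prod_seq => s sl st.
    apply: commrB; apply: commr_sym; apply: commrB;
      by [apply: hc => //; apply: ins|apply: hx; apply: ins|apply/commr_sym/hx; apply: ins].
  apply/comm_prod_seq => s sl st.
  apply: commrB; apply: commr_sym; apply: commrB;
    by [|apply: hc => //; apply: ins|apply: hx|apply/commr_sym/hx|apply: hx; apply: ins|apply/commr_sym/hx; apply: ins].
have ivf t a : t \in t0 :: l -> GRing.comm z (f a) -> GRing.comm (c t) a -> GRing.comm (f a) (iv t).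
  move=> tl za ca; apply: (@comm_inverse _ _ (z - f (c t))); [exact: ivr|exact: ivl|].
  by apply: commrB; [apply: commr_sym|apply: commf; apply: commr_sym].
have zx0 : GRing.comm z (f (x - c t0)) by rewrite rmorphB; apply: commrB => //; apply: zc.
have ivx t : t \in t0 :: l -> GRing.comm (f (x - c t0)) (iv t).
  move=> tl; apply: ivf => //; apply: commrB; [apply/commr_sym/hx|apply: hc] => //.
(* The resolvent identity, which separates the new pole from each old one. *)
have iviv t : t \in l -> iv t0 * iv t = (iv t - iv t0) * f (g t).
  move=> tl.
  have -> : iv t - iv t0 = iv t0 * iv t * f (c t - c t0).
    have -> : iv t - iv t0 = iv t0 * ((z - f (c t0)) - (z - f (c t))) * iv t.
      by rewrite mulrBr ivl // mulrBl mul1r -mulrA ivr' // mulr1.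
    rewrite opprB addrC addrA subrK -rmorphB -!mulrA; congr (_ * _).
    apply: ivf; [exact: ins| |].
      by rewrite rmorphB; apply: commrB; apply: zc => //; apply: ins.
    by apply: commrB; apply: hc => //; apply: ins.
  by rewrite -!mulrA -rmorphM mulrV ?gu // rmorph1 mulr1.
rewrite -head0 in resid; rewrite -head1 in resid.
rewrite [in RHS]big_cons.
under [X in _ = 1 - (_ + X)]eq_big_seq => t tl do rewrite wE //.
rewrite resid !big_cons rmorphM.
rewrite -mulrA [X in _ * X](_ : _ = f (x - c t0) * ((\prod_(t <- l) iv t) * f (\prod_(t <- l) (x - c t)))); last first.
  rewrite !mulrA; congr (_ * _); apply/esym/comm_prod_seq => t tl _; apply: ivx; exact: ins.
rewrite (IH ul' hc' hu' hx' A f z iv zx zc' ivl' ivr').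
have -> : iv t0 * (f (x - c t0) * (1 - \sum_(t <- l) iv t * f (w t) * (z - f x))) =
   iv t0 * f (x - c t0) - \sum_(t <- l) (iv t - iv t0) * f (g t * (x - c t0) * w t) * (z - f x).
  rewrite mulrA mulrBr mulr1 mulr_sumr; congr (_ - _).
  rewrite big_seq [RHS]big_seq; apply: eq_bigr => t tl.
  rewrite !mulrA; congr (_ * _); rewrite -[_ * f (x - c t0) * iv t]mulrA ivx ?ins //.
  by rewrite mulrA iviv // !rmorphM -!mulrA.
have -> : iv t0 * f (x - c t0) = 1 - iv t0 * (z - f x).
  rewrite -(ivl t0) // -mulrBr; congr (_ * _).
  by rewrite rmorphB opprB [RHS]addrC addrA subrK.
rewrite -addrA -opprD; congr (1 - _).
under [X in _ + X = _]eq_bigr => t _ do rewrite mulrBl mulrBl.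
rewrite sumrB.
rewrite [f (1 - _)]rmorphB rmorph1 [iv t0 * (1 - _)]mulrBr mulr1 [in RHS]mulrBl rmorph_sum mulr_sumr mulr_suml.
by rewrite -addrA [X in _ = _ + X]addrC.
Qed.

(** Take x = c t0 in the preceding identity for the tail of the list and divide by z - c t0 and by
    the product of the c t0 - c t. For an empty list the two sides would be 1 and 0. *)
Lemma partial_fractions (l : seq nat) :
  uniq l -> l != [::] ->
  (forall t s, t \in l -> s \in l -> GRing.comm (c t) (c s)) ->
  (forall t s, t \in l -> s \in l -> t != s -> c t - c s \is a GRing.unit) ->
  forall (A : nzRingType) (f : {rmorphism R -> A}) (z : A) (iv : nat -> A),
  (forall t, t \in l -> GRing.comm z (f (c t))) ->
  (forall t, t \in l -> iv t * (z - f (c t)) = 1) ->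
  (forall t, t \in l -> (z - f (c t)) * iv t = 1) ->
  \prod_(t <- l) iv t =
  \sum_(t <- l) iv t * f (\prod_(s <- l | s != t) (c t - c s))^-1.
Proof.
case: l => [|t0 l] // ul _ hc hu A f z iv zc ivl ivr.
have /andP[t0l ul'] := ul.
have in0 : t0 \in t0 :: l by rewrite mem_head.
have ins t : t \in l -> t \in t0 :: l by rewrite inE orbC => ->.
have neq t : t \in l -> t0 != t by move=> tl; apply: contraNneq t0l => ->.
have gu t : t \in l -> c t0 - c t \is a GRing.unit.
  by move=> tl; apply: hu => //; [apply: ins|apply: neq].
have cc t s u v : t \in t0 :: l -> s \in t0 :: l -> u \in t0 :: l -> v \in t0 :: l ->
    GRing.comm (c t - c s) (c u - c v).
  by move=> *; apply: commrB; apply: commr_sym; apply: commrB; apply: hc.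
pose d0 := (\prod_(s <- l) (c t0 - c s))^-1.
have d0u : \prod_(s <- l) (c t0 - c s) \is a GRing.unit.
  by rewrite big_seq; apply: rpred_prod => s sl; apply: gu.
have head0 : \prod_(s <- t0 :: l | s != t0) (c t0 - c s) = \prod_(s <- l) (c t0 - c s).
  by rewrite big_cons eqxx /= big_seq_cond [RHS]big_seq; apply: eq_bigl => s;
     case sl: (s \in l) => //=; rewrite eq_sym neq.
have := @partial_fractions_eval l (c t0) ul'.
move=> /(_ (fun t s tl sl => hc t s (ins t tl) (ins s sl))
  (fun t s tl sl => hu t s (ins t tl) (ins s sl)) (fun t tl => hc t0 t in0 (ins t tl))
  A f z iv (zc t0 in0) (fun t tl => zc t (ins t tl))
  (fun t tl => ivl t (ins t tl)) (fun t tl => ivr t (ins t tl))) E.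
have PE : \prod_(t <- l) iv t =
    ((\prod_(t <- l) iv t) * f (\prod_(t <- l) (c t0 - c t))) * f d0.
  by rewrite -mulrA -rmorphM mulrV ?rmorph1 ?mulr1.
rewrite big_cons PE E [RHS]big_cons head0 -/d0 mulrBl mul1r mulrBr.
congr (_ + _).
rewrite mulr_suml mulr_sumr -sumrN big_seq [RHS]big_seq; apply: eq_bigr => t tl.
have hdu : \prod_(s <- l | s != t) (c t - c s) \is a GRing.unit.
  rewrite big_seq_cond; apply: rpred_prod => s /andP[sl st].
  by apply: hu; rewrite 1?eq_sym //; apply: ins.
rewrite big_cons neq //=.
have comm0 : GRing.comm (z - f (c t0)) (iv t).
  apply: (@comm_inverse _ _ (z - f (c t))); [exact/ivr/ins|exact/ivl/ins|].
  have zz := commr_refl z.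
  apply: commrB; apply: commr_sym; apply: commrB => //.
  - by apply: zc.
  - by apply/commr_sym/zc/ins.
  - by rewrite /GRing.comm -!rmorphM hc //; apply: ins.
set W := _^-1 * _.
have commW : GRing.comm (z - f (c t0)) (f W).
  have zW : GRing.comm z (f W).
    rewrite /W rmorphM; apply: commrM; last first.
      rewrite rmorph_prod; apply: comm_prod_seq => s sl _.
      by rewrite rmorphB; apply: commrB; apply: zc => //; apply: ins.
    apply: (@comm_inverse _ _ (f (\prod_(s <- l | s != t) (c t - c s)))).
    - by rewrite -rmorphM mulrV // rmorph1.
    - by rewrite -rmorphM mulVr // rmorph1.
    rewrite rmorph_prod; apply: comm_prod_seq => s sl _.
    by rewrite rmorphB; apply: commrB; apply: zc => //; apply: ins.
  apply: commr_sym; apply: commrB; first exact: commr_sym.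
  rewrite /GRing.comm -!rmorphM; congr (f _); apply: commr_sym; rewrite /W; apply: commrM.
    by apply/commrV/comm_prod_seq => s sl _; apply: commrB; apply: hc => //; apply: ins.
  by apply/comm_prod_seq => s sl _; apply: commrB; apply: hc => //; apply: ins.
have -> : iv t0 * (iv t * f W * (z - f (c t0)) * f d0) = iv t * (f W * f d0).
  rewrite -[iv t * f W * _]mulrA -commW [iv t * _]mulrA -comm0 !mulrA ivl //.
  by rewrite mul1r.
rewrite -rmorphM -mulrN -rmorphN; congr (_ * f _).
have Pu : \prod_(s <- l | s != t) (c t0 - c s) \is a GRing.unit.
  by rewrite big_seq_cond; apply: rpred_prod => s /andP[sl st]; apply: gu.
have -> : d0 = (\prod_(s <- l | s != t) (c t0 - c s))^-1 * (c t0 - c t)^-1.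
  rewrite /d0 -invrM ?gu //; congr (_^-1).
  by apply: prod_comm_D1 => // s sl; apply: cc => //; apply: ins.
rewrite /W invrM //; last by (apply: hu; [exact: ins|exact: in0|rewrite eq_sym neq]).
rewrite -(opprB (c t0)) invrN mulrN; congr (- _).
by rewrite mulrA -[_ * _ / \prod_(s <- l | s != t) (c t0 - c s)]mulrA mulrV // mulr1.
Qed.
End PartialFractions.

(** * Cancellation of poles along chains *)

Section Polar.
Variable R : unitRingType.

Definition is_lpoly (x : laurent R) := exists f, x = lpoly f.

Lemma is_lpolyD x y : is_lpoly x -> is_lpoly y -> is_lpoly (x + y).
Proof. by move=> [f ->] [g ->]; exists (f + g); rewrite rmorphD. Qed.
Lemma is_lpolyN x : is_lpoly x -> is_lpoly (- x).
Proof. by move=> [f ->]; exists (- f); rewrite rmorphN. Qed.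
Lemma is_lpolyM x y : is_lpoly x -> is_lpoly y -> is_lpoly (x * y).
Proof. by move=> [f ->] [g ->]; exists (f * g); rewrite rmorphM. Qed.
Lemma is_lpolyC c : is_lpoly (lC c).
Proof. by exists c%:P; rewrite lpolyC. Qed.
Lemma is_lpoly0 : is_lpoly 0.
Proof. by exists 0; rewrite rmorph0. Qed.
Lemma is_lpoly_poly f : is_lpoly (lpoly f).
Proof. by exists f. Qed.
Lemma is_lpoly_sum (I : eqType) (s : seq I) (F : I -> laurent R) :
  (forall i, i \in s -> is_lpoly (F i)) -> is_lpoly (\sum_(i <- s) F i).
Proof.
move=> h; rewrite big_seq; apply: big_ind => //; [exact: is_lpoly0|exact: is_lpolyD].
Qed.

Lemma comm_XsubC (a b : R) : GRing.comm a b -> GRing.comm ('X - a%:P) ('X - b%:P).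
Proof.
move=> ab; apply: commrB; first exact: commr_polyX.
apply: commr_sym; apply: commrB; first exact: commr_polyX.
by rewrite /GRing.comm -!polyCM ab.
Qed.

Lemma linv_commC (a c : R) : GRing.comm a c -> GRing.comm (lC a) (linv c).
Proof. by move=> ac; apply: linv_intertwine. Qed.

(** This separates the pole at x from those at the c t. In [right_series_polar] the point x is a
    pole [y m r] of the right factor. *)
Lemma linv_polar (l : seq nat) (c : nat -> R) (x : R) :
  uniq l ->
  (forall t s, t \in l -> s \in l -> GRing.comm (c t) (c s)) ->
  (forall t s, t \in l -> s \in l -> t != s -> c t - c s \is a GRing.unit) ->
  (forall t, t \in l -> GRing.comm x (c t)) ->
  (\prod_(t <- l) linv (c t)) * (lC (\prod_(t <- l) (x - c t)) * linv x) =
  linv x - \sum_(t <- l) linv (c t) * lC ((\prod_(s <- l | s != t) (c t - c s))^-1 *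
                             \prod_(s <- l | s != t) (x - c s)).
Proof.
move=> ul hc hu hx.
rewrite mulrA (@partial_fractions_eval R c l x ul hc hu hx (laurent R) lC (lZ1 R) (fun t => linv (c t))).
- rewrite mulrBl mul1r; congr (_ - _); rewrite mulr_suml; apply: eq_bigr => t _.
  by rewrite -!mulrA linvVr mulr1.
- exact: lZ1_comm.
- by move=> t _; exact: lZ1_comm.
- by move=> t _; exact: linvVl.
- by move=> t _; exact: linvVr.
Qed.

Lemma linv_prod (l : seq nat) (c : nat -> R) :
  uniq l -> l != [::] ->
  (forall t s, t \in l -> s \in l -> GRing.comm (c t) (c s)) ->
  (forall t s, t \in l -> s \in l -> t != s -> c t - c s \is a GRing.unit) ->
  \prod_(t <- l) linv (c t) =
  \sum_(t <- l) linv (c t) * lC (\prod_(s <- l | s != t) (c t - c s))^-1.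
Proof.
move=> ul l0 hc hu.
apply: (@partial_fractions R c l ul l0 hc hu (laurent R) lC (lZ1 R) (fun t => linv (c t))).
- by move=> t _; exact: lZ1_comm.
- by move=> t _; exact: linvVl.
- by move=> t _; exact: linvVr.
Qed.

(** * Residues at one node of the chain *)

Section Node.
(** [J] and [K] are the coefficients that the left and the right chain have accumulated at this
    node, [U] and [V] its left and right shift operators, and [N] the left polynomial of the
    neighbouring node. [zt] and [zp] carry the factors Z_k, and [d r] will be the inverse of the
    product of the c r - c t. *)
Variables (l : seq nat) (y c : nat -> R) (dl : R) (d U V K J : nat -> R) (N zt zp : {poly R}).
Definition Ppoly r : {poly R} := \prod_(t <- l | t != r) ('X - (y t)%:P).
Hypothesis ul : uniq l.
Hypothesis dlc : forall x : R, GRing.comm x dl.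
Hypothesis cE : forall r, r \in l -> c r = y r + dl.
Hypothesis yc : forall t s, t \in l -> s \in l -> GRing.comm (y t) (y s).
Hypothesis Uy : forall r, r \in l -> U r * y r = c r * U r.
Hypothesis Uyc : forall r t, r \in l -> t \in l -> r != t -> GRing.comm (U r) (y t).
(** The compatibility of the two shift operators that equates the residues. For T it is
    [lower_raise], for T' it is [raise_lower]. *)
Hypothesis UV : forall r, r \in l ->
  (\prod_(t <- l | t != r) (c r - y t)) * (U r * V r) = zp.[c r] * d r.
Hypothesis NJ : forall r, r \in l -> J r = N.[c r].
Hypothesis Nc : forall r i, r \in l -> GRing.comm N`_i (y r).
Hypothesis zpc : forall i x, GRing.comm zp`_i x.

Lemma Ppoly_coef_comm a r :
  (forall t, t \in l -> t != r -> GRing.comm a (y t)) -> comm_coef (Ppoly r) a.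
Proof.
move=> ha i.
have : GRing.comm (a%:P) (Ppoly r).
  rewrite /Ppoly; apply: comm_prod_seq => t tl tr.
  apply: commrB; first exact: commr_polyX.
  by rewrite /GRing.comm -!polyCM ha.
by move/(congr1 (fun p : {poly R} => p`_i)); rewrite coefCM coefMC.
Qed.

Let cc r t : r \in l -> t \in l -> GRing.comm (c r) (y t).
Proof. by move=> rl tl; rewrite cE //; apply: commr_sym; apply: commrD; [apply: yc|apply: dlc]. Qed.
Let Jy r t : r \in l -> t \in l -> GRing.comm (J r) (y t).
Proof.
move=> rl tl; rewrite NJ //; apply: commr_sym; apply: commr_horner; first exact/commr_sym/cc.
by move=> i; apply: Nc.
Qed.
Let Jc r t : r \in l -> t \in l -> GRing.comm (J r) (c t).
Proof. by move=> rl tl; rewrite cE //; apply: commrD; [apply: Jy|apply: dlc]. Qed.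

Lemma Ppoly_horner a r : (forall t, t \in l -> GRing.comm a (y t)) ->
  (Ppoly r).[a] = \prod_(t <- l | t != r) (a - y t).
Proof.
move=> ha; rewrite /Ppoly.
elim: (l) (ha) => [|t s IH] has; first by rewrite !big_nil hornerC.
have h' u : u \in s -> GRing.comm a (y u) by move=> us; apply: has; rewrite inE us orbT.
rewrite !big_cons; case: ifP => _; last exact: IH.
rewrite hornerM_comm ?hornerXsubC ?IH // /comm_poly IH //.
apply: comm_prod_seq => u us _; apply: commrB; [exact: commr_refl|exact: h'].
Qed.

(* The residues of consecutive summands at the points [c r] are opposite; after the shift
   by [U r], the second sum has its only surviving poles there. *)
Lemma node_cancel :
  is_lpoly (lpoly (zt * zp * N) * (\sum_(r <- l) linv (c r) * lC (d r * K r)) -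
            lpoly (zt * \sum_(r <- l) Ppoly r * (J r * U r)%:P) *
              (\sum_(r <- l) linv (y r) * lC (V r * K r))).
Proof.
(* The common polar part of the two sums at [c r]. *)
pose A r := lC (zt.[c r] * zp.[c r] * J r) * (linv (c r) * lC (d r * K r)).
have first_ r : r \in l -> is_lpoly (lpoly (zt * zp * N) * (linv (c r) * lC (d r * K r)) - A r).
  move=> rl; have [q hq] := lpoly_factor (zt * zp * N) (c r).
  rewrite mulrA hq /A NJ //.
  rewrite hornerM_comm; last by apply: comm_coef_poly => i; rewrite cE //; apply: commrD; [apply: Nc|apply: dlc].
  rewrite hornerM_comm; last by apply: comm_coef_poly => i; apply: zpc.
  by rewrite mulrDl -!mulrA addrK; apply: is_lpolyM; [exact: is_lpoly_poly|exact: is_lpolyC].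
(* For t different from r, [J r * U r] commutes with [y t], so the resolvent reaches [Ppoly r] and
   is cancelled by its factor z - y t. *)
have cross r t : r \in l -> t \in l -> r != t ->
    is_lpoly (lpoly (zt * Ppoly r) * (lC (J r * U r) * (linv (y t) * lC (V t * K t)))).
  move=> rl tl rt.
  have h : GRing.comm (lC (J r * U r)) (linv (y t)).
    apply: linv_commC; apply: commr_sym; apply: commrM; first exact/commr_sym/Jy.
    exact/commr_sym/Uyc.
  rewrite mulrA -[_ * lC (J r * U r) * _]mulrA [lC (J r * U r) * _]mulrA h.
  rewrite [lpoly _ * _]mulrA -!mulrA mulrA.
  apply: is_lpolyM; last by apply: is_lpolyM; exact: is_lpolyC.
  have -> : Ppoly r = (\prod_(u <- l | (u != r) && (u != t)) ('X - (y u)%:P)) * ('X - (y t)%:P).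
    rewrite /Ppoly; have tin : t \in [seq u <- l | u != r] by rewrite mem_filter eq_sym rt.
    rewrite -big_filter (@prod_comm_D1 _ _ _ _ t) ?filter_uniq //; last first.
      by move=> u; rewrite mem_filter => /andP[_ us]; apply: comm_XsubC; apply: yc.
    by rewrite big_filter_cond; apply: comm_prod_seq => u us _; apply: comm_XsubC; apply: yc.
  rewrite !rmorphM rmorphB /= lpolyX lpolyC -!mulrA linvVr mulr1.
  by rewrite -rmorphM; exact: is_lpoly_poly.
(* For t = r, [U r] moves the pole from [y r] to [c r]. The value of [Ppoly r] there is the product
   that [UV] converts into [zp.[c r] * d r]. *)
have diag r : r \in l ->
    is_lpoly (lpoly (zt * Ppoly r) * (lC (J r * U r) * (linv (y r) * lC (V r * K r))) - A r).
  move=> rl.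
  have JUc : lC (J r * U r) * linv (y r) = linv (c r) * lC (J r * U r).
    by apply: linv_intertwine; rewrite -mulrA Uy // mulrA (Jc rl rl) mulrA.
  have Pc x : (forall t, t \in l -> GRing.comm x (y t)) -> GRing.comm x (c r) ->
     GRing.comm x (\prod_(t <- l | t != r) (c r - y t)).
    by move=> h1 h2; apply: comm_prod_seq => t tl _; apply: commrB; [|apply: h1].
  set P := \prod_(t <- l | t != r) (c r - y t) in Pc *.
  have cP : GRing.comm P (c r) by apply/commr_sym/Pc; [move=> t; apply: cc|exact: commr_refl].
  have JP : GRing.comm (J r) P by apply: Pc; [move=> t; apply: Jy|exact: Jc].
  have zJ : GRing.comm (J r) zp.[c r].
    apply: commr_horner; first exact: Jc.
    by move=> i; exact: zpc.
  have zC : GRing.comm zp.[c r] (c r).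
    apply: commr_sym; apply: commr_horner; first exact: commr_refl.
    by move=> i; exact: zpc.
  have AE : lC (zt.[c r] * P) * linv (c r) * (lC (J r * U r) * lC (V r * K r)) = A r.
    have mv a b : GRing.comm b (c r) -> lC (a * b) * linv (c r) = lC a * linv (c r) * lC b.
      by move=> h; rewrite rmorphM -mulrA (linv_commC h) mulrA.
    have zJc : GRing.comm (zp.[c r] * J r) (c r).
      by apply: commr_sym; apply: commrM; [apply: commr_sym|apply/commr_sym/Jc].
    have lCM3 (a b e : R) : lC a * (lC b * lC e) = lC (a * b * e) by rewrite !rmorphM mulrA.
    have lCM2 (a b : R) : lC a * lC b = lC (a * b) by rewrite rmorphM.
    have -> : A r = lC zt.[c r] * linv (c r) * lC (zp.[c r] * J r) * lC (d r * K r).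
      by rewrite /A -[zt.[c r] * _ * _]mulrA mulrA (mv _ _ zJc).
    rewrite (mv _ _ cP).
    rewrite -mulrA -[RHS]mulrA; congr (_ * _).
    rewrite lCM3 lCM2; congr lC.
    rewrite -[zp.[c r] * J r]zJ [P * (J r * U r)]mulrA -JP -!mulrA; congr (_ * _).
    by rewrite [U r * _]mulrA mulrA UV // mulrA.
  have [q hq] := lpoly_factor (zt * Ppoly r) (c r).
  rewrite [lC (J r * U r) * _]mulrA JUc -mulrA mulrA hq.
  rewrite hornerM_comm; last first.
    by apply: comm_coef_poly; apply: Ppoly_coef_comm => t tl _; apply: cc.
  rewrite Ppoly_horner; last by move=> t tl; apply: cc.
  rewrite -/P mulrDl AE addrK.
  by do 2?apply: is_lpolyM; first exact: is_lpoly_poly; exact: is_lpolyC.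
have -> : lpoly (zt * zp * N) * (\sum_(r <- l) linv (c r) * lC (d r * K r)) -
      lpoly (zt * \sum_(r <- l) Ppoly r * (J r * U r)%:P) *
              (\sum_(r <- l) linv (y r) * lC (V r * K r)) =
    \sum_(r <- l) (lpoly (zt * zp * N) * (linv (c r) * lC (d r * K r)) - A r)
    - \sum_(r <- l) (\sum_(t <- l | t != r)
        lpoly (zt * Ppoly r) * (lC (J r * U r) * (linv (y t) * lC (V t * K t)))
     + (lpoly (zt * Ppoly r) * (lC (J r * U r) * (linv (y r) * lC (V r * K r))) - A r)).
  rewrite sumrB -mulr_sumr.
  have -> : lpoly (zt * \sum_(r <- l) Ppoly r * (J r * U r)%:P) *
              (\sum_(r <- l) linv (y r) * lC (V r * K r)) =
    \sum_(r <- l) \sum_(t <- l) lpoly (zt * Ppoly r) * (lC (J r * U r) * (linv (y t) * lC (V t * K t))).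
    rewrite [zt * _]mulr_sumr [lpoly _]rmorph_sum mulr_suml; apply: eq_bigr => r _.
    rewrite -!mulr_sumr [RHS]mulrA; congr (_ * _).
    by rewrite mulrA [LHS]rmorphM /= lpolyC.
  under [X in _ - X = _]eq_big_seq => r rl do rewrite (bigD1_seq r rl ul) /= addrC.
  under [X in _ = _ - X]eq_bigr => r _ do rewrite addrA.
  by rewrite sumrB opprB addrA subrK.
apply: is_lpolyD; first exact: is_lpoly_sum.
apply/is_lpolyN/is_lpoly_sum => r rl; apply: is_lpolyD; last exact: diag.
rewrite -big_filter; apply: is_lpoly_sum => t; rewrite mem_filter => /andP[tr tl].
by apply: cross => //; rewrite eq_sym.
Qed.
End Node.
End Polar.

(* Both T and T' are sums of products [left_series * diagonal * right_series]
   along consecutive nodes [m], with [c = y + 1] or [c = y - 1] and [W] an operator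
   carrying [y] to [c] (left) or [c] to [y] (right).  For T the nodes are taken
   in the order [m = n - i]; for T' in the order [m = i], with the roles of [y] and
   [c] exchanged.  The index [m0] (resp. [m1]) is where the unit diagonal entry of the
   triangular factor sits. *)
Section ChainSeries.
Variable R : unitRingType.
Variables (l : nat -> seq nat) (y c : nat -> nat -> R) (W : nat -> nat -> R).

(** Summing chains one node at a time replaces the sum over tuples by a recursion, so that the
    comparison of consecutive summands becomes local to one node. The value at m = 0 is a dummy,
    since only m above m0 matters. *)
Fixpoint left_coef (m0 m r : nat) : R :=
  match m with
  | 0 => 0
  | m'.+1 =>
    if m' == m0 then \prod_(t <- l m') (c m r - y m' t)
    else \sum_(u <- l m') (\prod_(t <- l m' | t != u) (c m r - y m' t)) *
                          (left_coef m0 m' u * W m' u)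
  end.

Definition left_series (m0 m : nat) : laurent R :=
  if m == m0 then 1 else \sum_(r <- l m) linv (c m r) * lC (left_coef m0 m r * W m r).

Fixpoint right_coef (m1 m r : nat) : R :=
  match m with
  | 0 => 0
  | m'.+1 =>
    if m' == m1 then 1
    else \sum_(u <- l m') (\prod_(t <- l m | t != r) (y m' u - c m t)) *
                          (W m' u * right_coef m1 m' u)
  end.

(** The prefactor is the monic polynomial with roots [c m.+1 t] at the pole [y m r]; for T with m =
    n - i it is P_(i-1)(p_(i,r) - 1). The inverse of the same polynomial in z is a factor of
    [diag_series], so that [linv_polar] applies to their product. *)
Definition right_series (m1 m : nat) : laurent R :=
  if m == m1 then 1 else
  - \sum_(r <- l m) lC (\prod_(t <- l m.+1) (y m r - c m.+1 t)) *
                    (linv (y m r) * lC (W m r * right_coef m1 m r)).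

End ChainSeries.

(** * Chain series over an abstract family of nodes *)

Section Frame.
Variable R : unitRingType.
Variables (n : nat) (l : nat -> seq nat) (y c : nat -> nat -> R) (dl : R) (U V : nat -> nat -> R).
Hypothesis ul : forall m, uniq (l m).
Hypothesis dlc : forall x : R, GRing.comm x dl.
Hypothesis cE : forall m r, c m r = y m r + dl.
Hypothesis yc : forall m m' t s, (m <= n)%N -> (m' <= n)%N -> t \in l m -> s \in l m' ->
  GRing.comm (y m t) (y m' s).
Hypothesis yu : forall m t s, (m <= n)%N -> t \in l m -> s \in l m -> t != s ->
  y m t - y m s \is a GRing.unit.
Hypothesis Uy : forall m r, (m <= n)%N -> r \in l m -> U m r * y m r = c m r * U m r.
Hypothesis Uyc : forall m r m' t, (m <= n)%N -> (m' <= n)%N -> r \in l m -> t \in l m' ->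
  (m, r) != (m', t) -> GRing.comm (U m r) (y m' t).

Let cy m m' t s : (m <= n)%N -> (m' <= n)%N -> t \in l m -> s \in l m' ->
  GRing.comm (c m t) (y m' s).
Proof.
by move=> *; rewrite cE; apply: commr_sym; apply: commrD; [apply: yc|apply: dlc].
Qed.
Let cc m m' t s : (m <= n)%N -> (m' <= n)%N -> t \in l m -> s \in l m' ->
  GRing.comm (c m t) (c m' s).
Proof. by move=> *; rewrite (cE m'); apply: commrD; [apply: cy|apply: dlc]. Qed.
Let cd m t s : c m t - c m s = y m t - y m s.
Proof. by rewrite !cE opprD addrACA subrr addr0. Qed.
Let Ucc m r m' t : (m <= n)%N -> (m' <= n)%N -> r \in l m -> t \in l m' ->
  (m, r) != (m', t) -> GRing.comm (U m r) (c m' t).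
Proof. by move=> *; rewrite cE; apply: commrD; [apply: Uyc|apply: dlc]. Qed.

(** The coefficient at node m involves only y and c of nodes up to m and operators U of nodes
    strictly below m, so it shifts no y of node m or later. *)
Lemma left_coef_comm m0 m m' r t : (m <= m')%N -> (m' <= n)%N -> r \in l m -> t \in l m' ->
  GRing.comm (y m' t) (left_coef l y c U m0 m r).
Proof.
elim: m r => [|m IH] r mm' m'n rl tl /=; first exact: commr0.
have mn : (m.+1 <= n)%N by apply: leq_trans mm' m'n.
have h u : u \in l m -> GRing.comm (y m' t) (c m.+1 r - y m u).
  by move=> um; apply: commrB; [apply/commr_sym/cy|apply: yc => //; apply: ltnW].
case: ifP => _; first by apply: comm_prod_seq => u um _; apply: h.
apply: comm_sum_seq => u um _; apply: commrM; first by apply: comm_prod_seq => v vm _; apply: h.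
apply: commrM; first by apply: IH => //; apply: ltnW.
apply/commr_sym/Uyc => //; first exact: ltnW.
by rewrite xpair_eqE; apply/negP => /andP[/eqP e _]; rewrite e ltnn in mm'.
Qed.

Definition left_poly (m0 m : nat) : {poly R} :=
  if m == m0 then \prod_(t <- l m) ('X - (y m t)%:P)
  else \sum_(r <- l m) Ppoly (l m) (y m) r * (left_coef l y c U m0 m r * U m r)%:P.

Lemma lpoly_prod (s : seq nat) (P : pred nat) (f : nat -> R) :
  lpoly (\prod_(t <- s | P t) ('X - (f t)%:P)) = \prod_(t <- s | P t) (lZ1 R - lC (f t)).
Proof. by rewrite rmorph_prod; apply: eq_bigr => t _; rewrite rmorphB /= lpolyX lpolyC. Qed.

(** Moving [U m r] across z - y m r turns this factor into z - c m r, which cancels the pole of the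
    left series. *)
Lemma left_series_poly m0 m : (m0 <= m <= n)%N ->
  left_series l y c U m0 m * \prod_(t <- l m) (lZ1 R - lC (y m t)) = lpoly (left_poly m0 m).
Proof.
move=> /andP[m0m mn]; rewrite /left_series /left_poly; case: ifP => [_|_].
  by rewrite mul1r lpoly_prod.
rewrite rmorph_sum mulr_suml big_seq [RHS]big_seq; apply: eq_bigr => r rl.
rewrite [RHS]rmorphM /= lpolyC /Ppoly lpoly_prod.
set J := left_coef _ _ _ _ _ _ _.
have Jc t : t \in l m -> GRing.comm (y m t) J by move=> tl; apply: left_coef_comm.
have lcomm (a b : R) : GRing.comm a b -> GRing.comm (lZ1 R - lC a) (lC b).
  move=> ab; apply/commr_sym/commrB; first by apply/commr_sym; apply: lZ1_comm.
  by rewrite /GRing.comm -!rmorphM ab.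
rewrite (@prod_comm_D1 _ _ _ _ r) //; last first.
  move=> t tl; apply: commrB; first by apply/commr_sym; apply: lZ1_comm.
  by apply: lcomm; apply: yc.
rewrite mulrA -[_ * lC (J * U m r) * _]mulrA.
have -> : lC (J * U m r) * (lZ1 R - lC (y m r)) = (lZ1 R - lC (c m r)) * lC (J * U m r).
  rewrite mulrBr mulrBl -[_ * lZ1 R]lZ1_comm -!rmorphM -mulrA Uy //; congr (_ - lC _).
  by rewrite !mulrA; congr (_ * _); rewrite cE; apply: commrD; [apply/commr_sym/Jc|apply: dlc].
rewrite mulrA linvVl mul1r; apply: comm_prod_seq => t tl tr.
apply/commr_sym/lcomm; apply: commrM; first exact: Jc.
by apply/commr_sym/Uyc => //; apply: contraNneq tr => -[->].
Qed.

(** The recursion is evaluation: all coefficients at node m.+1 are values of one polynomial, the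
    form in which [node_cancel] takes them ([NJ]). *)
Lemma left_coef_horner m0 m r : (m0 <= m)%N -> (m < n)%N -> r \in l m.+1 ->
  left_coef l y c U m0 m.+1 r = (left_poly m0 m).[c m.+1 r].
Proof.
move=> m0m mn rl /=; rewrite /left_poly.
have ch t : t \in l m -> GRing.comm (c m.+1 r) (y m t) by move=> tl; apply: cy => //; apply: ltnW.
case: ifP => _.
  elim: (l m) ch => [|t s IH] ch; first by rewrite !big_nil hornerC.
  rewrite !big_cons IH; last by move=> u us; apply: ch; rewrite inE us orbT.
  rewrite hornerM_comm ?hornerXsubC // /comm_poly -IH; last first.
    by move=> u us; apply: ch; rewrite inE us orbT.
  apply: comm_prod_seq => u us _; apply: commrB; first exact: commr_refl.
  by apply: ch; rewrite inE us orbT.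
rewrite horner_sum big_seq [RHS]big_seq; apply: eq_bigr => u um.
rewrite hornerM_comm ?hornerC ?Ppoly_horner // /comm_poly hornerC.
apply: commrM.
  rewrite cE; apply: commr_sym; apply: commrD; last exact: dlc.
  apply: commr_sym.
  by apply: left_coef_comm.
apply/commr_sym/Ucc => //; first exact: ltnW.
by rewrite xpair_eqE; apply/negP => /andP[/eqP e _]; lia.
Qed.

Lemma left_poly_comm m0 m r i : (m0 <= m)%N -> (m < n)%N -> r \in l m.+1 ->
  GRing.comm (left_poly m0 m)`_i (y m.+1 r).
Proof.
move=> m0m mn rl.
suff h : GRing.comm (y m.+1 r)%:P (left_poly m0 m).
  by have := congr1 (fun p : {poly R} => p`_i) h; rewrite /= coefCM coefMC /GRing.comm => ->.
have hX t : t \in l m -> GRing.comm (y m.+1 r)%:P ('X - (y m t)%:P).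
  move=> tl; apply: commrB; first exact: commr_polyX.
  by rewrite /GRing.comm -!polyCM yc //; apply: ltnW.
rewrite /left_poly; case: ifP => _; first by apply: comm_prod_seq => t tl _; apply: hX.
apply: comm_sum_seq => u um _; apply: commrM; first by apply: comm_prod_seq => t tl _; apply: hX.
rewrite /GRing.comm -!polyCM; congr (_%:P); apply: commrM; first exact: left_coef_comm.
apply/commr_sym/Uyc => //; first exact: ltnW.
by rewrite xpair_eqE; apply/negP => /andP[/eqP e _]; lia.
Qed.

(** * Inverting a triangular factor by telescoping *)

Section Inverse.
(** [kap] and [rt] stand for the right coefficients and right series of the other chain, whose nodes
    run in the opposite order. Their recursions are all that enters. *)
Variable kap : nat -> nat -> R.
Variables m0 m1 : nat.
Hypothesis m01 : (m0 < m1 < n)%N.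
Hypothesis kap1 : forall r, kap m1 r = 1.
Hypothesis kapS : forall m r, (m < m1)%N -> kap m r =
  \sum_(u <- l m.+1) (\prod_(t <- l m | t != r) (c m.+1 u - y m t)) * (U m.+1 u * kap m.+1 u).
Variable rt : nat -> laurent R.
Hypothesis rt1 : rt m1 = 1.
Hypothesis rtE : forall m, (m < m1)%N -> rt m =
  - \sum_(u <- l m.+1) lC (\prod_(t <- l m) (c m.+1 u - y m t)) *
                    (linv (c m.+1 u) * lC (U m.+1 u * kap m.+1 u)).

Let Y m := \sum_(u <- l m) linv (c m u) * lC (left_coef l y c U m0 m u * U m u * kap m u).

Let Jcc m m' r t : (m <= m')%N -> (m' <= n)%N -> r \in l m -> t \in l m' ->
  GRing.comm (c m' t) (left_coef l y c U m0 m r).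
Proof.
move=> *; rewrite cE; apply/commr_sym/commrD; last exact: dlc.
exact/commr_sym/left_coef_comm.
Qed.

Lemma chain_inverse_step m : (m0 < m < m1)%N -> left_series l y c U m0 m * rt m = Y m - Y m.+1.
Proof.
move=> /andP[m0m mm1]; have mn : (m < n)%N by lia.
have mn' : (m <= n)%N by exact: ltnW.
rewrite /left_series ifF; last by lia.
rewrite rtE // mulrN mulr_suml.
pose J t := left_coef l y c U m0 m t.
pose P u t := \prod_(s <- l m | s != t) (c m.+1 u - y m s).
have Pc u t x : (forall s, s \in l m -> s != t -> GRing.comm x (y m s)) ->
    GRing.comm x (c m.+1 u) -> GRing.comm x (P u t).
  by move=> h1 h2; apply: comm_prod_seq => s sl st; apply: commrB => //; apply: h1.
have JUc u t : u \in l m.+1 -> t \in l m -> GRing.comm (J t * U m t) (c m.+1 u).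
  move=> um tm; apply: commr_sym; apply: commrM; first by apply: Jcc.
  by apply/commr_sym/Ucc => //; rewrite xpair_eqE; apply/negP => /andP[/eqP e _]; lia.
have JUP u t : u \in l m.+1 -> t \in l m -> GRing.comm (J t * U m t) (P u t).
  move=> um tm; apply: Pc; last exact: JUc.
  move=> s sl st; apply: commr_sym; apply: commrM; first exact: left_coef_comm.
  by apply/commr_sym/Uyc => //; apply: contraNneq st => -[->].
(* Carrying [U m t] over the factor c m.+1 u - y m t produces c m.+1 u - c m t, which is the
   numerator in the difference of the two resolvents. *)
have key u t : u \in l m.+1 -> t \in l m ->
   linv (c m t) * lC (J t * U m t) *
     (lC (\prod_(s <- l m) (c m.+1 u - y m s)) * (linv (c m.+1 u) * lC (U m.+1 u * kap m.+1 u)))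
   = (linv (c m.+1 u) - linv (c m t)) * lC (J t * U m t * (P u t * (U m.+1 u * kap m.+1 u))).
  move=> um tm.
  have tr : J t * U m t * (\prod_(s <- l m) (c m.+1 u - y m s)) =
      (c m.+1 u - c m t) * (J t * U m t * P u t).
    rewrite (@prod_comm_D1 _ _ _ _ t) //; last first.
      move=> s sm; apply: commrB; apply: commr_sym; apply: commrB; first exact: commr_refl.
      - by apply: cy.
      - by apply/commr_sym/cy.
      - by apply: yc.
    rewrite [LHS]mulrA -/(P u t) [RHS]mulrA; congr (_ * _).
    rewrite mulrBr mulrBl -JUc //; congr (_ - _).
    rewrite -mulrA Uy // !mulrA; congr (_ * _).
    by apply/commr_sym/Jcc.
  have cP : GRing.comm (J t * U m t * P u t) (c m.+1 u).
    apply: commr_sym; apply: commrM; first exact/commr_sym/JUc.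
    apply: Pc; last exact: commr_refl.
    by move=> s sl _; apply: cy.
  have -> : linv (c m.+1 u) - linv (c m t) = linv (c m t) * lC (c m.+1 u - c m t) * linv (c m.+1 u).
    have -> : lC (c m.+1 u - c m t) = (lZ1 R - lC (c m t)) - (lZ1 R - lC (c m.+1 u)).
      by rewrite rmorphB opprB [RHS]addrC addrA subrK.
    by rewrite mulrBr mulrBl linvVl mul1r -mulrA linvVr mulr1.
  rewrite -mulrA [lC (J t * U m t) * _]mulrA -lCM tr lCM.
  rewrite -[lC _ * lC (J t * U m t * P u t) * _]mulrA.
  rewrite [lC (J t * U m t * P u t) * (_ * _)]mulrA (linv_commC cP).
  by rewrite -[linv _ * lC (_ * P u t) * _]mulrA -lCM !mulrA.
have -> : \sum_(i <- l m) linv (c m i) * lC (left_coef l y c U m0 m i * U m i) *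
     (\sum_(u <- l m.+1) lC (\prod_(t <- l m) (c m.+1 u - y m t)) *
                        (linv (c m.+1 u) * lC (U m.+1 u * kap m.+1 u))) =
   \sum_(t <- l m) \sum_(u <- l m.+1)
     (linv (c m.+1 u) - linv (c m t)) * lC (J t * U m t * (P u t * (U m.+1 u * kap m.+1 u))).
  rewrite big_seq [RHS]big_seq; apply: eq_bigr => t tm; rewrite mulr_sumr.
  by rewrite big_seq [RHS]big_seq; apply: eq_bigr => u um; apply: key.
under eq_bigr => t _ do under eq_bigr => u _ do rewrite mulrBl.
under eq_bigr => t _ do rewrite sumrB.
(* The terms with pole at [c m] are summed over u by [kapS] into [Y m]. Those with pole at [c m.+1]
   are summed over t by the recursion of [left_coef] into [Y m.+1]. *)
rewrite sumrB opprB; congr (_ - _).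
  apply: eq_bigr => t _; rewrite -mulr_sumr -rmorph_sum -mulr_sumr.
  by rewrite kapS.
rewrite exchange_big /= big_seq [RHS]big_seq; apply: eq_bigr => u um.
rewrite -mulr_sumr -rmorph_sum; congr (_ * lC _).
rewrite /= ifF; last by lia.
rewrite -mulrA mulr_suml big_seq [RHS]big_seq; apply: eq_bigr => t tm.
by rewrite mulrA JUP.
Qed.

(** This is the entry (m0, m1) of a product of unitriangular matrices. The inner terms telescope to
    Y (m0 + 1) - Y m1, and the two end terms, in which one factor is 1, contribute -Y (m0 + 1) and Y
    m1. *)
Lemma chain_inverse : \sum_(m0 <= m < m1.+1) left_series l y c U m0 m * rt m = 0.
Proof.
have /andP[h0 h1] := m01.
rewrite big_nat_recr /=; last by lia.
rewrite big_ltn //.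
have -> : \sum_(m0.+1 <= m < m1) left_series l y c U m0 m * rt m = Y m0.+1 - Y m1.
  rewrite (@eq_big_nat _ _ _ _ _ _ (fun m => - (Y m.+1 - Y m))); last first.
    by move=> m hm; rewrite chain_inverse_step // opprB.
  by rewrite sumrN telescope_sumr // opprB.
have -> : left_series l y c U m0 m0 * rt m0 = - Y m0.+1.
  rewrite /left_series eqxx mul1r rtE //; congr (- _).
  rewrite big_seq [RHS]big_seq; apply: eq_bigr => u um.
  rewrite /= eqxx mulrA (linv_commC _) -?mulrA -?rmorphM -?mulrA //.
  apply: commr_sym; apply: comm_prod_seq => t tm _; apply: commrB; first exact: commr_refl.
  by apply: cy => //; lia.
have -> : left_series l y c U m0 m1 * rt m1 = Y m1.
  rewrite rt1 mulr1 /left_series ifF; last by lia.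
  by apply: eq_bigr => u _; rewrite kap1 mulr1.
by rewrite addrA addNr sub0r addNr.
Qed.
End Inverse.

(** * Polynomiality of the chain sums *)

Variable zp : nat -> {poly R}.
Variable zt : nat -> {poly R}.
Hypothesis zpc : forall m i x, GRing.comm (zp m)`_i x.
Hypothesis ztc : forall m x, GRing.comm (lpoly (zt m)) x.
Hypothesis ztS : forall m, (m < n)%N -> zt m = zt m.+1 * zp m.+1.
Let d m r := (\prod_(t <- l m | t != r) (c m r - c m t))^-1.
Hypothesis UV : forall m r, (m < n)%N -> r \in l m ->
  (\prod_(t <- l m | t != r) (c m r - y m t)) * (U m r * V m r) = (zp m).[c m r] * d m r.
Hypothesis l_neq0 : forall m, (0 < m < n)%N -> l m != [::].
Hypothesis ln : l n = [::].

Definition diag_series m : laurent R :=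
  (\prod_(t <- l m) (lZ1 R - lC (y m t))) * (\prod_(t <- l m.+1) linv (c m.+1 t)) * lpoly (zt m).

Let Gp m1 m := \sum_(r <- l m.+1) linv (c m.+1 r) * lC (d m.+1 r * right_coef l y c V m1 m.+1 r).
Let Hp m1 m := if m == m1 then 0 else
  \sum_(r <- l m) linv (y m r) * lC (V m r * right_coef l y c V m1 m r).

(** [Gp] collects the poles at the next node and [Hp] those at the node m itself. For m = m1 the
    right series is 1, and the side condition ensures that there is a denominator to expand. *)
Lemma right_series_polar (m1 m : nat) : (m < n)%N -> (l m.+1 != [::]) || (m != m1) ->
  (\prod_(t <- l m.+1) linv (c m.+1 t)) * right_series l y c V m1 m = Gp m1 m - Hp m1 m.
Proof.
move=> mn hl.
have hc t s : t \in l m.+1 -> s \in l m.+1 -> GRing.comm (c m.+1 t) (c m.+1 s).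
  by move=> *; apply: cc.
have hu t s : t \in l m.+1 -> s \in l m.+1 -> t != s -> c m.+1 t - c m.+1 s \is a GRing.unit.
  by move=> *; rewrite cd; apply: yu.
rewrite /right_series /Gp /Hp /=; case: (eqVneq m m1) hl => [_|_ _].
  rewrite /= orbF => hl; rewrite mulr1 subr0 linv_prod //.
  by apply: eq_bigr => t _; rewrite mulr1.
rewrite mulrN mulr_sumr.
have -> : \sum_(r <- l m) (\prod_(t <- l m.+1) linv (c m.+1 t)) *
      (lC (\prod_(t <- l m.+1) (y m r - c m.+1 t)) *
         (linv (y m r) * lC (V m r * right_coef l y c V m1 m r))) =
   \sum_(r <- l m) (linv (y m r) - \sum_(t <- l m.+1) linv (c m.+1 t) * lC (d m.+1 t *
                             \prod_(s <- l m.+1 | s != t) (y m r - c m.+1 s))) *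
       lC (V m r * right_coef l y c V m1 m r).
  rewrite big_seq [RHS]big_seq; apply: eq_bigr => r rl.
  rewrite [lC _ * (_ * _)]mulrA mulrA linv_polar //.
  by move=> t tl; apply/commr_sym/cy => //; apply: ltnW.
under [X in - X = _]eq_bigr => r _ do rewrite mulrBl mulr_suml.
rewrite sumrB opprB exchange_big /=; congr (_ - _).
apply: eq_bigr => t _; rewrite mulr_sumr rmorph_sum mulr_sumr.
by apply: eq_bigr => r _; rewrite -[LHS]mulrA; congr (_ * _); rewrite -rmorphM -mulrA.
Qed.

(** Summand m is A m - B m, and A m - B (m + 1) is polynomial by [node_cancel]. At the lower end B M
    has lost its poles; at the upper end A (n - 1) vanishes because node n is empty. *)
Lemma chain_sum_poly (m0 m1 : nat) : (m0 < n)%N -> (m1 < n)%N ->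
  is_lpoly (\sum_(maxn m0 m1 <= m < n)
     left_series l y c U m0 m * (diag_series m * right_series l y c V m1 m)).
Proof.
move=> m0n m1n.
set M := maxn m0 m1.
have Mn : (M < n)%N by rewrite gtn_max m0n.
have termE m : (m0 <= m)%N -> (m < n)%N ->
    left_series l y c U m0 m * (diag_series m * right_series l y c V m1 m) =
    lpoly (left_poly m0 m) * lpoly (zt m) *
    ((\prod_(t <- l m.+1) linv (c m.+1 t)) * right_series l y c V m1 m).
  move=> m0m mn; rewrite /diag_series -[_ * _ * lpoly _]mulrA.
  rewrite -[_ * lpoly (zt m)]ztc -left_series_poly; last by rewrite m0m ltnW.
  by rewrite !mulrA.
(* An empty node m1 + 1 forces m1 + 1 = n. The sum is then one summand without denominators. *)
have [ln1|ln1] := boolP ((l m1.+1 != [::])); last first.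
  have e : m1.+1 = n.
    by apply/eqP; rewrite eqn_leq m1n leqNgt; apply: contra ln1 => h; apply: l_neq0.
  have eM : M = m1 by rewrite /M; lia.
  rewrite eM -e big_nat1 termE ?e //; last by rewrite -ltnS e.
  rewrite ln big_nil mul1r /right_series eqxx mulr1.
  by apply: is_lpolyM; exact: is_lpoly_poly.
pose A m := lpoly (zt m * left_poly m0 m) * Gp m1 m.
pose B m := lpoly (zt m * left_poly m0 m) * Hp m1 m.
have termE' m : (M <= m)%N -> (m < n)%N ->
    left_series l y c U m0 m * (diag_series m * right_series l y c V m1 m) = A m - B m.
  move=> Mm mn; rewrite termE //; last by apply: leq_trans Mm; apply: leq_maxl.
  rewrite right_series_polar //; last by case: (eqVneq m m1) => [->|_]; rewrite ?ln1 ?orbT.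
  by rewrite mulrBr /A /B rmorphM ztc.
have stp m : (M <= m)%N -> (m.+1 < n)%N -> is_lpoly (A m - B m.+1).
  move=> Mm mn; rewrite /A /B /Hp /left_poly.
  have m0m : (m0 <= m)%N by apply: leq_trans Mm; apply: leq_maxl.
  have -> : (m.+1 == m1) = false by have := leq_maxr m0 m1; rewrite -/M; lia.
  have -> : (m.+1 == m0) = false by lia.
  rewrite ztS; last exact: ltnW.
  apply: (@node_cancel R (l m.+1) (y m.+1) (c m.+1) dl (d m.+1) (U m.+1) (V m.+1)
     (right_coef l y c V m1 m.+1) (left_coef l y c U m0 m.+1) (left_poly m0 m) (zt m.+1) (zp m.+1)) => //.
  - by move=> t s tl sl; apply: yc => //; apply: ltnW.
  - by move=> r rl; apply: Uy => //; apply: ltnW.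
  - by move=> r t rl tl rt; apply: Uyc => //; rewrite 1?ltnW // xpair_eqE eqxx.
  - by move=> r rl; apply: UV.
  - by move=> r rl; apply: left_coef_horner => //; apply: ltnW.
  - by move=> r i rl; apply: left_poly_comm => //; apply: ltnW.
(* If M = m1 then [Hp] is 0. Otherwise M = m0, and [left_poly] is the full product of the z - y,
   which removes every pole. *)
have firstB : is_lpoly (B M).
  rewrite /B /Hp; case: eqP => [_|/eqP Mm1]; first by rewrite mulr0; exact: is_lpoly0.
  have eM : M = m0 by rewrite /M in Mm1 *; lia.
  rewrite eM /left_poly eqxx rmorphM /= -mulrA; apply: is_lpolyM; first exact: is_lpoly_poly.
  rewrite mulr_sumr; apply: is_lpoly_sum => r rl.
  rewrite lpoly_prod (@prod_comm_D1 _ _ _ _ r) //; last first.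
    move=> t tl; apply: commrB; first by apply/commr_sym; apply: lZ1_comm.
    apply/commr_sym/commrB; first by apply/commr_sym; apply: lZ1_comm.
    by rewrite /GRing.comm -!rmorphM yc //; apply: ltnW.
  have -> : (lZ1 R - lC (y m0 r)) * \prod_(t <- l m0 | t != r) (lZ1 R - lC (y m0 t)) =
     (\prod_(t <- l m0 | t != r) (lZ1 R - lC (y m0 t))) * (lZ1 R - lC (y m0 r)).
    apply: comm_prod_seq => t tl _; apply: commrB; first by apply/commr_sym; apply: lZ1_comm.
    apply/commr_sym/commrB; first by apply/commr_sym; apply: lZ1_comm.
    by rewrite /GRing.comm -!rmorphM yc //; apply: ltnW.
  rewrite -mulrA [(_ - _) * (_ * _)]mulrA linvVr mul1r -lpoly_prod.
  by apply: is_lpolyM; [exact: is_lpoly_poly|exact: is_lpolyC].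
(* Invariant of the telescoping: the only poles of a partial sum are those of its last A. *)
have part q : (M + q < n)%N ->
   is_lpoly (\sum_(M <= m < (M + q).+1) (A m - B m) - A (M + q)%N).
  elim: q => [|q IH] hq.
    by rewrite addn0 big_nat1 addrC addrA addNr add0r; apply: is_lpolyN.
  rewrite addnS in hq *; rewrite big_nat_recr /=; last by lia.
  rewrite [A _ - _ in X in X - _]addrC addrA addrK.
  have -> : \sum_(M <= i < (M + q).+1) (A i - B i) - B (M + q).+1 =
     (\sum_(M <= i < (M + q).+1) (A i - B i) - A (M + q)%N) + (A (M + q)%N - B (M + q).+1).
    by rewrite addrA subrK.
  by apply: is_lpolyD; [apply: IH; apply: ltnW|apply: stp => //; apply: leq_addr].
have -> : \sum_(M <= m < n) left_series l y c U m0 m * (diag_series m * right_series l y c V m1 m) =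
    \sum_(M <= m < n) (A m - B m).
  by apply: eq_big_nat => m /andP[h1 h2]; apply: termE'.
have := part (n.-1 - M)%N; have -> : (M + (n.-1 - M) = n.-1)%N by lia.
rewrite prednK; last by lia.
move=> /(_ (ltac:(lia))).
have -> : A n.-1 = 0.
  by rewrite /A /Gp prednK ?ln ?big_nil ?mulr0 //; lia.
by rewrite subr0.
Qed.


(** * Degrees of the chain sums *)

Section Degree.
Variable dg : nat -> int.
Hypothesis dgE : forall m, (m < n)%N -> lmonic (dg m) (diag_series m).
Hypothesis dg1 : forall m, (m < n)%N -> dg m <= 1.

Lemma left_series_deg m0 m : ldeg_le (- (m != m0)%:Z) (left_series l y c U m0 m).
Proof.
rewrite /left_series; case: eqP => _ /=; first exact: (lmonic1 R).1.
apply: ldeg_le_sum => r _; rewrite -[- 1]addr0; apply: ldeg_leM; last exact: ldeg_lC.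
exact: (lmonic_linv _).1.
Qed.

Lemma right_series_deg m1 m : ldeg_le (- (m != m1)%:Z) (right_series l y c V m1 m).
Proof.
rewrite /right_series; case: eqP => _ /=; first exact: (lmonic1 R).1.
apply/ldeg_leN/ldeg_le_sum => r _; rewrite -[- 1]add0r; apply: ldeg_leM; first exact: ldeg_lC.
rewrite -[- 1]addr0; apply: ldeg_leM; last exact: ldeg_lC.
exact: (lmonic_linv _).1.
Qed.

Let chain_term m0 m1 m := left_series l y c U m0 m * (diag_series m * right_series l y c V m1 m).

Lemma chain_term_deg m0 m1 m : (m < n)%N ->
  ldeg_le (dg m - (m != m0)%:Z - (m != m1)%:Z) (chain_term m0 m1 m).
Proof.
move=> mn; rewrite -[dg m - _]addrC -addrA; apply: ldeg_leM; first exact: left_series_deg.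
by apply: ldeg_leM; [exact: (dgE mn).1|exact: right_series_deg].
Qed.

(** Every off-diagonal triangular factor lowers the degree by one. Beyond max(m0, m1) both factors
    are off-diagonal, which leaves at most 1 - 2 = -1. The first summand is the subtracted diagonal
    one if m0 = m1, and otherwise exactly one of its factors is off-diagonal. *)
Lemma chain_sum_deg (m0 m1 : nat) (e : int) : (m0 < n)%N -> (m1 < n)%N ->
  dg (maxn m0 m1) - 1 <= e -> - 1 <= e ->
  ldeg_le e (\sum_(maxn m0 m1 <= m < n) chain_term m0 m1 m - (m0 == m1)%:R * diag_series m0).
Proof.
move=> m0n m1n he he'.
rewrite big_ltn ?gtn_max ?m0n // addrAC; apply: ldeg_leD; last first.
  apply: ldeg_le_sum => m; rewrite mem_index_iota => hm.
  have mn : (m < n)%N by lia.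
  have := @chain_term_deg m0 m1 m mn; apply: ldeg_leW.
  have := dg1 mn; have -> : (m != m0) by lia.
  have -> : (m != m1) by lia.
  by rewrite /=; lia.
have [e01|ne] := eqVneq m0 m1.
  rewrite -e01 maxnn mul1r /chain_term /left_series /right_series eqxx mul1r mulr1 subrr.
  by move=> k _; rewrite laurent0.
have Mn : (maxn m0 m1 < n)%N by rewrite gtn_max m0n.
rewrite mul0r subr0; have := @chain_term_deg m0 m1 _ Mn; apply: ldeg_leW.
case: (eqVneq (maxn m0 m1) m0) => e1; case: (eqVneq (maxn m0 m1) m1) => e2 /=; lia.
Qed.
End Degree.

End Frame.

(** * The sums over tuples as chains *)

Lemma comm_alg (K : fieldType) (R : unitAlgType K) (x : R) (b : K) : GRing.comm x b%:A.
Proof. by rewrite /GRing.comm mulr_algl mulr_algr. Qed.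

Lemma rr_head (r : nat) t i : rr (r :: t) i i = r.
Proof. by rewrite /rr subnn. Qed.

Lemma rr_behead (r : nat) t i k : (i < k)%N -> rr (r :: t) i k = rr t i.+1 k.
Proof. by move=> ik; rewrite /rr -subSS subSn. Qed.

Lemma idx_tuplesS a i len t : t \in idx_tuples a i len.+1 ->
  exists r t', [/\ t = r :: t', r \in iota 1 (a i) & t' \in idx_tuples a i.+1 len].
Proof. by move=> /allpairsP[[r t'] /= [h1 h2 ->]]; exists r, t'. Qed.

Section Tuples.
Variables (K : fieldType) (R : unitAlgType K) (a : nat -> nat).
Variables (p eq eqi : nat -> nat -> R) (x1 : K) (ss n : nat).
Notation I i := (iota 1 (a i)).
Notation PJ := (Pev a p).
Notation PJr := (Prev a p).
Hypothesis pc : forall i k j l, (i <= n)%N -> (j <= n)%N -> k \in I i -> l \in I j ->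
  GRing.comm (p i k) (p j l).
Hypothesis pu : forall i k l (m : int), (i <= n)%N -> k \in I i -> l \in I i -> k != l ->
  p i k - p i l + m%:~R \is a GRing.unit.
Hypothesis eqc : forall i k j l, (i <= n)%N -> (j <= n)%N -> k \in I i -> l \in I j ->
  (i, k) != (j, l) -> GRing.comm (eq i k) (p j l).
Hypothesis eqic : forall i k j l, (i <= n)%N -> (j <= n)%N -> k \in I i -> l \in I j ->
  (i, k) != (j, l) -> GRing.comm (eqi i k) (p j l).
Hypothesis eqieqi : forall i k j l, (i <= n)%N -> (j <= n)%N -> k \in I i -> l \in I j ->
  GRing.comm (eqi i k) (eqi j l).

Definition raise i r : R := Zev x1 ss i (p i r) * (PJr i r (p i r))^-1 * eq i r.
Definition lower i r : R := (PJr i r (p i r))^-1 * eqi i r.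

Lemma comm_Prev i r x z : (forall t, t \in I i -> t != r -> GRing.comm z (p i t)) ->
  GRing.comm z x -> GRing.comm z (PJr i r x).
Proof. by move=> h hx; apply: comm_prod_seq => t tI tr; apply: commrB => //; apply: h. Qed.

Lemma comm_Pev i (x z : R) : (forall t, t \in I i -> GRing.comm z (p i t)) ->
  GRing.comm z x -> GRing.comm z (PJ i x).
Proof. by move=> h hx; apply: comm_prod_seq => t tI tr; apply: commrB => //; apply: h. Qed.

Lemma comm_Zev i (x z : R) : GRing.comm z x -> GRing.comm z (Zev x1 ss i x).
Proof.
move=> zx; rewrite /Zev; case: ifP => _; last exact: commr1.
by apply: commrB => //; apply: comm_alg.
Qed.

Lemma Prev_unit i r : (i <= n)%N -> r \in I i -> PJr i r (p i r) \is a GRing.unit.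
Proof.
move=> i_n rI; rewrite /Prev big_seq_cond; apply: rpred_prod => t /andP[tI tr].
by have := @pu i r t 0 i_n rI tI; rewrite addr0 eq_sym; apply.
Qed.

Definition eps_links i len t : R :=
  \prod_(k <- iota i len) PJr k (rr t i k) (p k.+1 (rr t i k.+1) - 1).
Definition phi_links i len t : R :=
  PJ (i + len).+1 (p (i + len)%N (rr t i (i + len)) + 1) *
  \prod_(k <- iota i.+1 len) PJr k (rr t i k) (p k.-1 (rr t i k.-1) + 1).
Definition denL i len t : R := \prod_(k <- iota i len) PJr k (rr t i k) (p k (rr t i k)).
Definition Zprod i len t : R := \prod_(k <- iota i len) Zev x1 ss k (p k (rr t i k)).
Definition eqprod i len t : R := \prod_(k <- iota i len) eq k (rr t i k).
Definition eqiprod i len t : R := \prod_(k <- iota i len) eqi k (rr t i k).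

Lemma iota_shift (f : nat -> nat -> R) r t i len :
  \prod_(k <- iota i.+1 len) f k (rr (r :: t) i k) = \prod_(k <- iota i.+1 len) f k (rr t i.+1 k).
Proof. by apply: eq_big_seq => k; rewrite mem_iota => /andP[ik _]; rewrite rr_behead. Qed.

Lemma denL_cons i len r t :
  denL i len.+1 (r :: t) = PJr i r (p i r) * denL i.+1 len t.
Proof.
by rewrite /denL /= big_cons rr_head (iota_shift (fun k u => PJr k u (p k u))).
Qed.
Lemma Zprod_cons i len r t :
  Zprod i len.+1 (r :: t) = Zev x1 ss i (p i r) * Zprod i.+1 len t.
Proof. by rewrite /Zprod /= big_cons rr_head (iota_shift (fun k u => Zev x1 ss k (p k u))). Qed.
Lemma eqprod_cons i len r t : eqprod i len.+1 (r :: t) = eq i r * eqprod i.+1 len t.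
Proof. by rewrite /eqprod /= big_cons rr_head (iota_shift eq). Qed.
Lemma eqiprod_cons i len r t : eqiprod i len.+1 (r :: t) = eqi i r * eqiprod i.+1 len t.
Proof. by rewrite /eqiprod /= big_cons rr_head (iota_shift eqi). Qed.
Lemma eps_links_cons i len r t :
  eps_links i len.+1 (r :: t) = PJr i r (p i.+1 (rr t i.+1 i.+1) - 1) * eps_links i.+1 len t.
Proof.
rewrite /eps_links /= big_cons rr_head rr_behead //; congr (_ * _).
by apply: eq_big_seq => k; rewrite mem_iota => /andP[ik _]; rewrite !rr_behead // ltnS ltnW.
Qed.

Lemma rr_mem i len t k : t \in idx_tuples a i len -> (i <= k < i + len)%N -> rr t i k \in I k.
Proof.
elim: len i t => [|len IH] i t; first by move=> _ h; lia.
move=> /idx_tuplesS[r [t' [-> rI tI]]] hk.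
have [->|ik] := eqVneq k i; first by rewrite rr_head.
by rewrite rr_behead; [apply: IH => //|]; lia.
Qed.

Section CommFrom.
Variables (i len : nat) (t : seq nat) (z : R).
Hypothesis tI : t \in idx_tuples a i len.
Hypothesis iln : (i + len <= n.+1)%N.
Hypothesis zp : forall j l, (i <= j <= n)%N -> l \in I j -> GRing.comm z (p j l).

Let zrr k : (i <= k < i + len)%N -> GRing.comm z (p k (rr t i k)).
Proof. by move=> hk; apply: zp; [lia|apply: rr_mem hk]. Qed.

Lemma comm_denL : GRing.comm z (denL i len t).
Proof.
apply: comm_prod_seq => k; rewrite mem_iota => hk _.
by apply: comm_Prev; [move=> u uI _; apply: zp => //; lia|apply: zrr].
Qed.
Lemma comm_Zprod : GRing.comm z (Zprod i len t).
Proof. by apply: comm_prod_seq => k; rewrite mem_iota => hk _; apply/comm_Zev/zrr. Qed.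
Lemma comm_eps_links len' : (len' < len)%N -> GRing.comm z (eps_links i len' t).
Proof.
move=> ll; apply: comm_prod_seq => k; rewrite mem_iota => hk _.
apply: comm_Prev; first by move=> u uI _; apply: zp => //; lia.
by apply: commrB; [apply: zrr; lia|exact: commr1].
Qed.
End CommFrom.

Lemma denL_unit i len t : t \in idx_tuples a i len -> (i + len <= n.+1)%N ->
  denL i len t \is a GRing.unit.
Proof.
move=> tI iln; rewrite /denL big_seq; apply: rpred_prod => k; rewrite mem_iota => hk.
by apply: Prev_unit; [lia|apply: rr_mem hk].
Qed.

(** Each shift operator stands at its own node instead of at the far right of the term; this order
    matches the recursion of [right_coef]. *)
Fixpoint eps_chain i r t : R :=
  if t is r' :: t' then raise i r * (PJr i r (p i.+1 r' - 1) * eps_chain i.+1 r' t')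
  else raise i r.

(** The exponential of (i, r) moves left without any shift: the factor linking i to i + 1 omits
    p_(i,r), and everything else it passes lies at nodes above i. *)
Lemma eps_reorder len i r t : r \in I i -> t \in idx_tuples a i.+1 len -> (i + len <= n)%N ->
  eps_links i len (r :: t) * (denL i len.+1 (r :: t))^-1 *
  (Zprod i len.+1 (r :: t) * eqprod i len.+1 (r :: t)) = eps_chain i r t.
Proof.
elim: len i r t => [|len IH] i r t rI tI iln.
  have -> : t = [::] by move: tI; rewrite inE => /eqP.
  rewrite /eps_links /denL /Zprod /eqprod /= !big_cons !big_nil !mulr1 !rr_head /raise mul1r.
  rewrite mulrA; congr (_ * _); apply/comm_Zev/commr_sym/commrV.
  by apply: comm_Prev => // u uI _; apply: pc => //; lia.
have [r' [t' [tE r'I t'I]]] := idx_tuplesS tI.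
have inn : (i <= n)%N by lia.
rewrite eps_links_cons denL_cons Zprod_cons eqprod_cons.
have -> : eps_chain i r t = raise i r * (PJr i r (p i.+1 r' - 1) * eps_chain i.+1 r' t').
  by rewrite tE.
rewrite -(IH i.+1 r' t') //; last by lia.
rewrite -tE (_ : rr t i.+1 i.+1 = r'); last by rewrite tE rr_head.
set L := eps_links _ _ _; set De := denL _ _ _; set Z := Zprod _ _ _; set E := eqprod _ _ _.
set P := PJr i r (p i r); set Q := PJr i r _; set z := Zev _ _ _ _.
have Pu : P \is a GRing.unit by apply: Prev_unit.
have Deu : De \is a GRing.unit by apply: denL_unit => //; lia.
have pcomm x : (forall j l, (i.+1 <= j <= n)%N -> l \in I j -> GRing.comm x (p j l)) ->
    (forall l, l \in I i -> l != r -> GRing.comm x (p i l)) ->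
    GRing.comm x (Q * L * De^-1 * Z).
  move=> h1 h2; have il : (i.+1 + len.+1 <= n.+1)%N by lia.
  apply: commrM; last exact: (comm_Zprod tI).
  apply: commrM; last exact/commrV/(comm_denL tI).
  apply: commrM; last exact: (comm_eps_links tI).
  apply: comm_Prev; first by move=> u uI ur; apply: h2.
  by apply: commrB; [apply: h1 => //; lia|exact: commr1].
have ec : GRing.comm (eq i r) (Q * L * De^-1 * Z).
  apply: pcomm => [j l hj lI|l lI lr]; apply: eqc => //; try lia.
    by rewrite xpair_eqE; apply/negP => /andP[/eqP e _]; lia.
  by rewrite xpair_eqE eqxx eq_sym.
have allp j l : (j <= n)%N -> l \in I j -> GRing.comm (p j l) (z * P^-1).
  move=> jn lI; apply: commrM; first by apply/comm_Zev/pc.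
  apply/commrV/comm_Prev; last by apply: pc.
  by move=> u uI _; apply: pc.
have zP : GRing.comm z P^-1.
  by apply/commr_sym/comm_Zev/commr_sym/commrV/comm_Prev => // u uI _; apply: pc.
have LHSE : Q * L * (P * De)^-1 * (z * Z * (eq i r * E)) = Q * L * De^-1 * (P^-1 * z) * Z * (eq i r * E).
  by rewrite invrM // !mulrA.
have zPc' : GRing.comm (z * P^-1) (Q * L * De^-1).
  have il : (i.+1 + len.+1 <= n.+1)%N by lia.
  have h1 j l : (i.+1 <= j <= n)%N -> l \in I j -> GRing.comm (z * P^-1) (p j l).
    by move=> hj lI; apply/commr_sym/allp => //; lia.
  apply: commrM; last exact/commrV/(comm_denL tI).
  apply: commrM; last exact: (comm_eps_links tI).
  apply: comm_Prev; first by move=> u uI ur; apply/commr_sym/allp.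
  by apply: commrB; [apply: h1 => //; lia|exact: commr1].
rewrite LHSE -zP -zPc' /raise -/z -/P.
by rewrite -!mulrA; congr (_ * (_ * _)); rewrite !mulrA -ec !mulrA.
Qed.

Fixpoint phi_chain i r t : R :=
  if t is r' :: t' then PJr i.+1 r' (p i r + 1) * phi_chain i.+1 r' t' * lower i r
  else PJ i.+1 (p i r + 1) * lower i r.

(** Here the operator of node i ends on the right. Its exponential must pass those of the higher
    nodes, where the commutation of the e^(-q) enters, and its denominator commutes with them
    because it only involves node i. *)
Lemma phi_reorder len i r t : r \in I i -> t \in idx_tuples a i.+1 len -> (i + len < n)%N ->
  phi_links i len (r :: t) * (denL i len.+1 (r :: t))^-1 * eqiprod i len.+1 (r :: t) =
  phi_chain i r t.
Proof.
elim: len i r t => [|len IH] i r t rI tI iln.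
  have -> : t = [::] by move: tI; rewrite inE => /eqP.
  rewrite /phi_links /denL /eqiprod /= !big_cons !big_nil !mulr1 addn0 !rr_head /lower.
  by rewrite mulrA.
have [r' [t' [tE r'I t'I]]] := idx_tuplesS tI.
have inn : (i <= n)%N by lia.
rewrite denL_cons eqiprod_cons.
have -> : phi_chain i r t = PJr i.+1 r' (p i r + 1) * phi_chain i.+1 r' t' * lower i r.
  by rewrite tE.
rewrite -(IH i.+1 r' t') //; last by lia.
rewrite -tE; set De := denL _ _ _; set E := eqiprod _ _ _; set L := phi_links i.+1 _ _.
set P := PJr i r (p i r); set Q := PJr i.+1 r' _.
have Pu : P \is a GRing.unit by apply: Prev_unit.
have Deu : De \is a GRing.unit by apply: denL_unit => //; lia.
have -> : phi_links i len.+1 (r :: t) = Q * L.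
  rewrite /phi_links /= big_cons -[i.+1.-1]/i rr_head addnS -addSn !rr_behead ?ltnS ?leq_addr //.
  rewrite {2}tE rr_head.
  have -> : \prod_(j <- iota i.+2 len) PJr j (rr (r :: t) i j) (p j.-1 (rr (r :: t) i j.-1) + 1)
     = \prod_(k <- iota i.+2 len) PJr k (rr t i.+1 k) (p k.-1 (rr t i.+1 k.-1) + 1).
    by apply: eq_big_seq => k; rewrite mem_iota => hk; rewrite !rr_behead //; lia.
  rewrite -/Q !mulrA; congr (_ * _).
  have kin : rr t i.+1 (i.+1 + len) \in I (i.+1 + len).
    by apply: rr_mem tI _; lia.
  apply: commr_sym; apply: comm_Pev.
    move=> u uI; apply: commr_sym; apply: comm_Prev; first by move=> v vI _; apply: pc => //; lia.
    by apply: commrD; [apply: pc => //; lia|exact: commr1].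
  apply: commrD; last exact: commr1.
  apply: commr_sym; apply: comm_Prev; first by move=> v vI _; apply: pc => //; lia.
  by apply: commrD; [apply: pc => //; lia|exact: commr1].
have PE : GRing.comm P^-1 E.
  apply: comm_prod_seq => k; rewrite mem_iota => hk _.
  have kin := rr_mem tI hk.
  apply/commr_sym/commrV/comm_Prev.
    move=> u uI ur; apply: eqic => //; try lia.
    by rewrite xpair_eqE; apply/negP => /andP[/eqP e _]; lia.
  apply: eqic => //; try lia.
  by rewrite xpair_eqE; apply/negP => /andP[/eqP e _]; lia.
have eE : GRing.comm (eqi i r) E.
  apply: comm_prod_seq => k; rewrite mem_iota => hk _.
  by apply: eqieqi => //; [lia|apply: rr_mem tI hk].
rewrite invrM // /lower -/P.
rewrite -!mulrA eE; do 3 congr (_ * _); congr (_ * _).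
by rewrite [LHS]mulrA PE -mulrA.
Qed.

Definition lT m := I (n - m).
Definition yT m r := p (n - m) r.
Definition cT m r := p (n - m) r + 1.
Definition UT m := lower (n - m).
Definition VT m := raise (n - m).

Lemma sub_shift (x b : R) : x - (b + 1) = x - 1 - b.
Proof. by rewrite opprD addrA addrAC. Qed.

(** Under m = n - i, reading a tuple from node i upwards is the downward recursion of [right_coef],
    which stops at n - j with j = i + len + 1. *)
Lemma eps_chain_sum len i r : (i + len < n)%N ->
  \sum_(t <- idx_tuples a i.+1 len) eps_chain i r t =
  raise i r * right_coef lT yT cT VT (n - (i + len).+1) (n - i) r.
Proof.
elim: len i r => [|len IH] i r iln.
  have -> : (n - i = (n - i.+1).+1)%N by lia.
  by rewrite /= addn0 eqxx big_seq1 mulr1.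
rewrite /= big_allpairs_dep /=.
have -> : (n - i = (n - i.+1).+1)%N by lia.
rewrite /= ifF; last by lia.
rewrite mulr_sumr /lT (_ : n - (n - i.+1) = i.+1)%N; last by lia.
apply: eq_bigr => u _; rewrite -!mulr_sumr; congr (_ * (_ * _)); last first.
  rewrite IH; last by lia.
  rewrite /VT (_ : n - (n - i.+1) = i.+1)%N; last by lia.
  by rewrite addSnnS.
rewrite /Prev (_ : n - (n - i.+1).+1 = i)%N; last by lia.
apply: eq_bigr => t _; rewrite /yT /cT sub_shift.
by rewrite (_ : n - (n - i.+1) = i.+1)%N 1?(_ : n - (n - i.+1).+1 = i)%N //; lia.
Qed.

Lemma phi_chain_sum len i r : (i + len < n)%N ->
  \sum_(t <- idx_tuples a i.+1 len) phi_chain i r t =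
  left_coef lT yT cT UT (n - (i + len).+1) (n - i) r * lower i r.
Proof.
elim: len i r => [|len IH] i r iln.
  have -> : (n - i = (n - i.+1).+1)%N by lia.
  rewrite /= addn0 eqxx big_seq1; congr (_ * _).
  rewrite /lT /Pev (_ : n - (n - i.+1) = i.+1)%N; last by lia.
  apply: eq_bigr => t _; rewrite /yT /cT.
  by rewrite (_ : n - (n - i.+1) = i.+1)%N 1?(_ : n - (n - i.+1).+1 = i)%N //; lia.
rewrite /= big_allpairs_dep /=.
have -> : (n - i = (n - i.+1).+1)%N by lia.
rewrite /= ifF; last by lia.
rewrite mulr_suml /lT (_ : n - (n - i.+1) = i.+1)%N; last by lia.
apply: eq_bigr => u _; rewrite -mulr_suml -mulr_sumr; congr (_ * _ * _); last first.
  rewrite IH; last by lia.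
  rewrite /UT (_ : n - (n - i.+1) = i.+1)%N; last by lia.
  by rewrite addSnnS.
rewrite /Prev; apply: eq_bigr => t _; rewrite /yT /cT.
by rewrite (_ : n - (n - i.+1) = i.+1)%N 1?(_ : n - (n - i.+1).+1 = i)%N //; lia.
Qed.

(** The resolvent stands between the scalars and the exponentials. The scalars only involve the p
    and so move to its right, except for P_(i-1)(p_(i,r) - 1), which [right_series] keeps in
    front. *)
Lemma laurent_of_eD i j : (0 < i)%N -> (i < j <= n)%N ->
  laurent_of (eD a p eq x1 ss i j) = right_series lT yT cT VT (n - j) (n - i).
Proof.
move=> i0 /andP[ij jn]; rewrite /eD /right_series ifF; last by lia.
rewrite ij ifF; last by lia.
rewrite laurent_of_opp laurent_of_sum big_map.
have [len jE] : exists len, j = (i + len).+1 by exists (j - i.+1)%N; lia.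
have -> : (j - i = len.+1)%N by lia.
rewrite /= big_allpairs_dep /=; congr (- _).
have hni : (n - (n - i) = i)%N by lia.
rewrite {1}/lT hni big_seq [RHS]big_seq; apply: eq_bigr => r rI.
have hni' : (n - (n - i).+1 = i.-1)%N by lia.
rewrite /VT hni jE -eps_chain_sum; last by lia.
rewrite [lC (\sum_(_ <- _) _)]rmorph_sum !mulr_sumr big_seq [RHS]big_seq; apply: eq_bigr => t tI.
rewrite -(@eps_reorder len) //; last by lia.
rewrite /eterm rr_head /= addKn (_ : (i + len).+1 - i = len.+1)%N; last by lia.
rewrite /denD (_ : (i + len).+1 - i = len.+1)%N; last by lia.
rewrite !laurent_of_mul -/(lC _) -/(lC _) -/(linv _).
rewrite -/(eps_links i len (r :: t)) -/(denL i len.+1 (r :: t)).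
rewrite -/(Zprod i len.+1 (r :: t)) -/(eqprod i len.+1 (r :: t)).
set Q := eps_links i len _ * (denL _ _ _)^-1.
have -> : PJ i.-1 (p i r - 1) * eps_links i len (r :: t) / denL i len.+1 (r :: t) =
   PJ i.-1 (p i r - 1) * Q by rewrite /Q mulrA.
have tI' : r :: t \in idx_tuples a i len.+1 by apply: allpairs_f.
have Qc : GRing.comm Q (p i r).
  have h j' l : (i <= j' <= n)%N -> l \in I j' -> GRing.comm (p i r) (p j' l).
    by move=> hj lI; apply: pc => //; lia.
  have il : (i + len.+1 <= n.+1)%N by lia.
  apply: commr_sym; apply: commrM; first exact: (comm_eps_links tI').
  exact/commrV/(comm_denL tI').
rewrite lCM -mulrA; congr (_ * _).
  congr lC; rewrite /Pev /lT hni'; apply: eq_bigr => u _.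
  by rewrite /yT /cT hni hni' sub_shift.
rewrite mulrA (linv_commC Qc) -mulrA -lCM /yT hni.
by [].
Qed.

Lemma laurent_of_fD i j : (0 < i)%N -> (i < j <= n)%N ->
  laurent_of (fD a p eqi j i) = left_series lT yT cT UT (n - j) (n - i).
Proof.
move=> i0 /andP[ij jn]; rewrite /fD /left_series ifF; last by lia.
rewrite ij ifF; last by lia.
rewrite laurent_of_sum big_map.
have [len jE] : exists len, j = (i + len).+1 by exists (j - i.+1)%N; lia.
have -> : (j - i = len.+1)%N by lia.
rewrite /= big_allpairs_dep /=.
have hni : (n - (n - i) = i)%N by lia.
rewrite {1}/lT hni big_seq [RHS]big_seq; apply: eq_bigr => r rI.
rewrite /UT hni jE -phi_chain_sum; last by lia.
rewrite [lC (\sum_(_ <- _) _)]rmorph_sum !mulr_sumr big_seq [RHS]big_seq; apply: eq_bigr => t tI.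
rewrite -(@phi_reorder len) //; last by lia.
rewrite /fterm rr_head /= addKn (_ : (i + len).+1 - i = len.+1)%N; last by lia.
rewrite /denD (_ : (i + len).+1 - i = len.+1)%N; last by lia.
rewrite !laurent_of_mul -/(lC _) -/(lC _) -/(linv _).
rewrite -/(denL i len.+1 (r :: t)) -/(eqiprod i len.+1 (r :: t)) -/(phi_links i len (r :: t)).
set Q := phi_links i len _ / _.
have tI' : r :: t \in idx_tuples a i len.+1 by apply: allpairs_f.
have h j' l : (i <= j' <= n)%N -> l \in I j' -> GRing.comm (p i r + 1) (p j' l).
  move=> hj lI; apply: commr_sym; apply: commrD; last exact: commr1.
  by apply: pc => //; lia.
have h' k : (i <= k < i + len.+1)%N -> GRing.comm (p i r + 1) (p k (rr (r :: t) i k) + 1).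
  move=> hk; apply: commrD; last exact: commr1.
  apply: h; last by apply: rr_mem hk.
  move: hk ij jn; rewrite jE; lia.
have Qc : GRing.comm Q (p i r + 1).
  have il : (i + len.+1 <= n.+1)%N by lia.
  apply: commr_sym; apply: commrM; last exact/commrV/(comm_denL tI').
  apply: commrM.
    apply: comm_Pev; last by apply: h'; lia.
    by move=> u uI; apply: h => //; lia.
  apply: comm_prod_seq => k; rewrite mem_iota => hk _; apply: comm_Prev.
    by move=> u uI _; apply: h => //; lia.
  by apply: h'; lia.
by rewrite mulrA (linv_commC Qc) -mulrA -lCM /cT hni.
Qed.
End Tuples.

(** * The matrices T and T' *)

(** Over a noncommutative ring a right inverse is not automatically a left inverse. Triangularity
    makes left multiplication by A injective, by induction on the row, and A (B A - 1) = 0. *)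
Lemma unitriangular_inverse (S : nzRingType) (n : nat) (A B : 'M[S]_n) :
  (forall i j : 'I_n, (i < j)%N -> A i j = 0) -> (forall i, A i i = 1) ->
  A *m B = 1%:M -> B *m A = 1%:M.
Proof.
move=> Atri A1 AB.
have inj (X : 'M[S]_n) : A *m X = 0 -> X = 0.
  move=> AX; apply/matrixP => i j; rewrite mxE.
  have [m im] := ubnP (i : nat); elim: m i im => // m IH i im.
  have := congr1 (fun M : 'M[S]_n => M i j) AX; rewrite !mxE (bigD1 i) //= A1 mul1r.
  rewrite big1 ?addr0 // => k ki.
  have [ik|ki'] := ltnP i k; first by rewrite Atri // mul0r.
  rewrite IH ?mulr0 //; have : (k : nat) != i by apply: contraNneq ki => e; apply/eqP/val_inj.
  by lia.
apply/eqP; rewrite -subr_eq0; apply/eqP/inj.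
by rewrite mulmxBr mulmxA AB mul1mx mulmx1 subrr.
Qed.

(** The upper right block of B A = z reads A_12 + B_12 = 0. Substituting B_12 = -A_12 into the upper
    left block A_11 + B_12 A_21 = z gives the claim. *)
Lemma schur_complement (S : nzRingType) (m n : nat) (A B : 'M[S]_(m + n)) (z : S) (i j : 'I_m) :
  (forall u v, (B *m A) u v = z * (u == v)%:R) ->
  (forall u v, B (lshift n u) (lshift n v) = (u == v)%:R) ->
  (forall u v, A (rshift m u) (rshift m v) = (u == v)%:R) ->
  A (lshift n i) (lshift n j) = z * (i == j)%:R +
  \sum_(q < n) A (lshift n i) (rshift m q) * A (rshift m q) (lshift n j).
Proof.
move=> BA Bul Alr.
have upper c : \sum_(k < m) B (lshift n i) (lshift n k) * A (lshift n k) c = A (lshift n i) c.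
  rewrite (bigD1 i) //= Bul eqxx mul1r big1 ?addr0 // => k ki.
  by rewrite Bul eq_sym (negbTE ki) mul0r.
have Bur q : B (lshift n i) (rshift m q) = - A (lshift n i) (rshift m q).
  apply/eqP; rewrite -addr_eq0 addrC; apply/eqP.
  have := BA (lshift n i) (rshift m q).
  rewrite eq_lrshift mulr0 mxE big_split_ord /= upper => <-; congr (_ + _).
  rewrite (bigD1 q) //= Alr eqxx mulr1 big1 ?addr0 // => k kq.
  by rewrite Alr (negbTE kq) mulr0.
have := BA (lshift n i) (lshift n j).
rewrite (inj_eq (@lshift_inj _ _)) mxE big_split_ord /= upper => <-.
rewrite -addrA -big_split /= big1 ?addr0 // => q _.
by rewrite Bur mulNr addNr.
Qed.

Lemma central_lpoly (R : nzRingType) (f : {poly R}) (x : laurent R) :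
  (forall i b, GRing.comm f`_i b) -> GRing.comm (lpoly f) x.
Proof.
elim/poly_ind: f => [|f c IH] h.
  by rewrite rmorph0; apply/commr_sym/commr0.
rewrite rmorphD rmorphM /= lpolyC lpolyX; apply: commr_sym; apply: commrD.
  apply: commrM; last by apply/commr_sym; apply: lZ1_comm.
  apply/commr_sym/IH => i b; have := h i.+1 b.
  by rewrite coefD coefMX coefC /= addr0.
have := h 0%N; rewrite coefD coefMX coefC /= add0r => hc.
by apply: laurentP => k; rewrite lCM_coef lMC_coef hc.
Qed.

(** Applied with u an exponential of (i, k) and the product over t != k: the exponential shifts the
    argument x = p i k and leaves the roots alone. *)
Lemma conj_prod (R : nzRingType) (I : eqType) (l : seq I) (P : pred I) (f : I -> R) (u x x' : R) :
  u * x = x' * u -> (forall t, t \in l -> P t -> GRing.comm u (f t)) ->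
  u * \prod_(t <- l | P t) (x - f t) = (\prod_(t <- l | P t) (x' - f t)) * u.
Proof.
move=> ux uf; rewrite big_seq_cond [in RHS]big_seq_cond.
elim/big_rec2: _ => [|t y1 y2 /andP[tl Pt] IH]; first by rewrite mulr1 mul1r.
by rewrite [LHS]mulrA mulrBr ux uf // -mulrBl -[LHS]mulrA IH mulrA.
Qed.

Lemma prod_resolvents (R : nzRingType) (l : seq nat) (f : nat -> R) :
  (forall t s, t \in l -> s \in l -> GRing.comm (f t) (f s)) ->
  (\prod_(t <- l) linv (f t)) * \prod_(t <- l) (lZ1 R - lC (f t)) = 1 /\
  (\prod_(t <- l) (lZ1 R - lC (f t))) * \prod_(t <- l) linv (f t) = 1.
Proof.
elim: l => [|t l IH] fc; first by rewrite !big_nil mulr1.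
have [h1 h2] : (\prod_(t <- l) linv (f t)) * \prod_(t <- l) (lZ1 R - lC (f t)) = 1 /\
  (\prod_(t <- l) (lZ1 R - lC (f t))) * \prod_(t <- l) linv (f t) = 1.
  by apply: IH => u v ul vl; apply: fc; rewrite inE ?ul ?vl orbT.
have tl s : s \in l -> GRing.comm (lZ1 R - lC (f t)) (lZ1 R - lC (f s)).
  move=> sl; apply: commrB; first by apply/commr_sym; apply: lZ1_comm.
  apply/commr_sym/commrB; first by apply/commr_sym; apply: lZ1_comm.
  by rewrite /GRing.comm -!lCM fc // inE ?eqxx ?sl ?orbT.
have c1 : GRing.comm (lZ1 R - lC (f t)) (\prod_(s <- l) (lZ1 R - lC (f s))).
  by apply: comm_prod_seq => s sl _; apply: tl.
have c2 : GRing.comm (\prod_(s <- l) linv (f s)) (lZ1 R - lC (f t)).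
  exact/commr_sym/(comm_inverse h2 h1)/c1.
rewrite !big_cons; split.
  rewrite -mulrA [(\prod_(s <- l) linv (f s)) * (_ * _)]mulrA c2 -mulrA h1 mulr1.
  exact: linvVl.
rewrite -mulrA [(\prod_(s <- l) (_ - _)) * (_ * _)]mulrA.
have c3 : GRing.comm (\prod_(s <- l) (lZ1 R - lC (f s))) (linv (f t)).
  by apply: (comm_inverse (linvVr _) (linvVl _)); exact/commr_sym/c1.
by rewrite c3 -mulrA h2 mulr1 linvVr.
Qed.

Section Main.
Variables (K : fieldType) (R : unitAlgType K) (a : nat -> nat).
Variables (p eq eqi : nat -> nat -> R) (x1 : K) (r s : nat).
Hypotheses (hr : (0 < r)%N) (hs : (0 < s)%N).
Let n := (r + s)%N.
Notation I i := (iota 1 (a i)).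
Notation PJ := (Pev a p).
Notation PJr := (Prev a p).
(** With truncated subtraction this is a_j = j - max(j - s, 0) - max(j - r, 0);
    [weight_multiplicity] derives it from the weight. *)
Hypothesis aE : forall j, (j <= n)%N -> (a j + (j - s) + (j - r) = j)%N.
Hypothesis pc : forall i k j l, (i <= n)%N -> (j <= n)%N -> k \in I i -> l \in I j ->
  GRing.comm (p i k) (p j l).
Hypothesis pu : forall i k l (m : int), (i <= n)%N -> k \in I i -> l \in I i -> k != l ->
  p i k - p i l + m%:~R \is a GRing.unit.
Hypothesis eqc : forall i k j l, (i <= n)%N -> (j <= n)%N -> k \in I i -> l \in I j ->
  (i, k) != (j, l) -> GRing.comm (eq i k) (p j l).
Hypothesis eqic : forall i k j l, (i <= n)%N -> (j <= n)%N -> k \in I i -> l \in I j ->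
  (i, k) != (j, l) -> GRing.comm (eqi i k) (p j l).
Hypothesis eqieqi : forall i k j l, (i <= n)%N -> (j <= n)%N -> k \in I i -> l \in I j ->
  GRing.comm (eqi i k) (eqi j l).
Hypothesis eqp : forall i k, (i <= n)%N -> k \in I i -> eq i k * p i k = (p i k - 1) * eq i k.
Hypothesis eqip : forall i k, (i <= n)%N -> k \in I i -> eqi i k * p i k = (p i k + 1) * eqi i k.
Hypothesis eqK : forall i k, (i <= n)%N -> k \in I i -> eq i k * eqi i k = 1.
Hypothesis eqiK : forall i k, (i <= n)%N -> k \in I i -> eqi i k * eq i k = 1.

Notation raise := (raise a p eq x1 s).
Notation lower := (lower a p eqi).
Notation lT := (lT a n).
Notation yT := (yT p n).
Notation cT := (cT p n).
Notation UT := (UT a p eqi n).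
Notation VT := (VT a p eq x1 s n).

Definition Zlin : {poly R} := 'X - (x1%:A)%:P.
Definition Zpoly (b : bool) : {poly R} := if b then Zlin else 1.

Lemma Zpoly_central b i z : GRing.comm (Zpoly b)`_i z.
Proof.
apply: commr_sym; rewrite /Zpoly /Zlin; case: b; last by rewrite coef1; apply: commr_nat.
rewrite coefB coefX coefC; apply: commrB; first exact: commr_nat.
by case: ifP => _; [rewrite /GRing.comm mulr_algl mulr_algr|exact: commr0]. 
Qed.

Lemma Zpoly_eval i z : (Zpoly (i == s)).[z] = Zev x1 s i z.
Proof. by rewrite /Zpoly /Zlin /Zev; case: ifP => _; rewrite ?hornerXsubC ?hornerC. Qed.

(** * Shift relations of the raising and lowering operators *)

Lemma Prev_unit_shift i k (m : int) : (i <= n)%N -> k \in I i -> PJr i k (p i k + m%:~R) \is a GRing.unit.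
Proof.
move=> i_n kI; rewrite /Prev big_seq_cond; apply: rpred_prod => t /andP[tI tk].
by rewrite addrAC; apply: pu => //; rewrite eq_sym.
Qed.

Lemma lower_p i k : (i <= n)%N -> k \in I i -> lower i k * p i k = (p i k + 1) * lower i k.
Proof.
move=> i_n kI; rewrite /lower -mulrA eqip // !mulrA; congr (_ * _).
apply/commr_sym/commrV/comm_Prev.
  move=> t tI _; apply/commr_sym/commrD; last exact: commr1.
  exact: pc.
by apply/commr_sym/commrD; [exact: commr_refl|exact: commr1].
Qed.

Lemma raise_p i k : (i <= n)%N -> k \in I i -> raise i k * p i k = (p i k - 1) * raise i k.
Proof.
move=> i_n kI; rewrite /raise -mulrA eqp // !mulrA; congr (_ * _).
have h t : t \in I i -> GRing.comm (p i k - 1) (p i t).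
  by move=> tI; apply/commr_sym/commrB; [exact: pc|exact: commr1].
rewrite -[RHS]mulrA; apply/commr_sym/commrM; first by apply/comm_Zev/h.
by apply/commrV/comm_Prev => [t tI _|]; exact: h.
Qed.

Lemma lower_comm i k j t : (i <= n)%N -> (j <= n)%N -> k \in I i -> t \in I j -> (i, k) != (j, t) ->
  GRing.comm (lower i k) (p j t).
Proof.
move=> i_n jn kI tI ne; apply/commr_sym/commrM; last exact/commr_sym/eqic.
by apply/commrV/comm_Prev => [u uI _|]; exact: pc.
Qed.

Lemma raise_comm i k j t : (i <= n)%N -> (j <= n)%N -> k \in I i -> t \in I j -> (i, k) != (j, t) ->
  GRing.comm (raise i k) (p j t).
Proof.
move=> i_n jn kI tI ne; apply/commr_sym/commrM; last exact/commr_sym/eqc.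
apply: commrM; first exact/comm_Zev/pc.
by apply/commrV/comm_Prev => [u uI _|]; exact: pc.
Qed.

Lemma conjV (u v x x' : R) : x \is a GRing.unit -> x' \is a GRing.unit ->
  u * v = 1 -> u * x = x' * u -> u * x^-1 * v = x'^-1.
Proof.
move=> xu xu' uv e; apply: (mulrI xu').
by rewrite mulrV // !mulrA -e -[u * x * _]mulrA mulrV // mulr1.
Qed.

(** Moving e^(-q) rightwards to meet e^q shifts p to p + 1 in Z and in the second denominator. The
    shifted denominator cancels the prefactor. *)
Lemma lower_raise i k : (i <= n)%N -> k \in I i ->
  PJr i k (p i k + 1) * (lower i k * raise i k) =
  Zev x1 s i (p i k + 1) * (PJr i k (p i k))^-1.
Proof.
move=> i_n kI; rewrite /lower /raise.
have P1u := @Prev_unit_shift i k 1 i_n kI.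
have P0u := @Prev_unit_shift i k 0 i_n kI.
rewrite addr0 in P0u.
have ec t : t \in I i -> t != k -> GRing.comm (eqi i k) (p i t).
  by move=> tI tk; apply: eqic => //; rewrite xpair_eqE eqxx eq_sym.
have e1 : eqi i k * PJr i k (p i k) = PJr i k (p i k + 1) * eqi i k.
  by apply: conj_prod; [exact: eqip|move=> t tI tk; apply: ec].
have e2 : eqi i k * Zev x1 s i (p i k) = Zev x1 s i (p i k + 1) * eqi i k.
  rewrite /Zev; case: ifP => _; last by rewrite mulr1 mul1r.
  by rewrite mulrBl mulrBr eqip // mulr_algl mulr_algr.
have -> : (PJr i k (p i k))^-1 * eqi i k * (Zev x1 s i (p i k) * (PJr i k (p i k))^-1 * eq i k) =
    (PJr i k (p i k))^-1 * Zev x1 s i (p i k + 1) * (PJr i k (p i k + 1))^-1.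
  rewrite -(conjV P0u P1u (eqiK i_n kI) e1) !mulrA; congr (_ * _ * _).
  by rewrite -mulrA e2 !mulrA.
have p1 t : t \in I i -> GRing.comm (p i k + 1) (p i t).
  by move=> tI; apply/commr_sym/commrD; [exact: pc|exact: commr1].
have c1 : GRing.comm (p i k) (PJr i k (p i k + 1)).
  by apply: comm_Prev => [t tI _|]; [exact: pc|exact/commr_sym/p1].
have c2 : GRing.comm (PJr i k (p i k + 1)) (PJr i k (p i k)).
  apply: comm_Prev => [t tI _|]; last by apply: commr_sym.
  apply: commr_sym; apply: comm_Prev => [u uI _|]; first exact: pc.
  exact/commr_sym/p1.
have c3 : GRing.comm (PJr i k (p i k + 1)) (Zev x1 s i (p i k + 1)).
  by apply: comm_Zev; apply: commrD; [apply: commr_sym|exact: commr1].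
have c4 : GRing.comm (PJr i k (p i k))^-1 (Zev x1 s i (p i k + 1)).
  apply: commr_sym; apply: commrV; apply: commr_sym; apply: comm_Zev.
  apply: commrD; last exact: commr1.
  by apply: commr_sym; apply: comm_Prev => [t tI _|]; [exact: pc|exact: commr_refl].
rewrite c4 !mulrA c3 -[_ * PJr i k (p i k + 1) * _]mulrA.
have -> : PJr i k (p i k + 1) * (PJr i k (p i k))^-1 = (PJr i k (p i k))^-1 * PJr i k (p i k + 1).
  exact: commrV.
by rewrite -!mulrA mulrV // mulr1.
Qed.

(** The mirror case. Z stands to the left of e^q and keeps its argument. *)
Lemma raise_lower i k : (i <= n)%N -> k \in I i ->
  PJr i k (p i k - 1) * (raise i k * lower i k) =
  Zev x1 s i (p i k) * (PJr i k (p i k))^-1.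
Proof.
move=> i_n kI; rewrite /lower /raise.
have P1u := @Prev_unit_shift i k (-1) i_n kI.
have P0u := @Prev_unit_shift i k 0 i_n kI.
rewrite addr0 in P0u; rewrite mulrN1z in P1u.
have ec t : t \in I i -> t != k -> GRing.comm (eq i k) (p i t).
  by move=> tI tk; apply: eqc => //; rewrite xpair_eqE eqxx eq_sym.
have e1 : eq i k * PJr i k (p i k) = PJr i k (p i k - 1) * eq i k.
  by apply: conj_prod; [exact: eqp|move=> t tI tk; apply: ec].
have -> : Zev x1 s i (p i k) * (PJr i k (p i k))^-1 * eq i k * ((PJr i k (p i k))^-1 * eqi i k) =
    Zev x1 s i (p i k) * (PJr i k (p i k))^-1 * (PJr i k (p i k - 1))^-1.
  by rewrite -(conjV P0u P1u (eqK i_n kI) e1) !mulrA.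
have p1 t : t \in I i -> GRing.comm (p i k - 1) (p i t).
  by move=> tI; apply/commr_sym/commrB; [exact: pc|exact: commr1].
have c1 : GRing.comm (p i k) (PJr i k (p i k - 1)).
  by apply: comm_Prev => [t tI _|]; [exact: pc|exact/commr_sym/p1].
have c2 : GRing.comm (PJr i k (p i k - 1)) (PJr i k (p i k)).
  apply: comm_Prev => [t tI _|]; last by apply: commr_sym.
  apply: commr_sym; apply: comm_Prev => [u uI _|]; first exact: pc.
  exact/commr_sym/p1.
have c3 : GRing.comm (PJr i k (p i k - 1)) (Zev x1 s i (p i k) * (PJr i k (p i k))^-1).
  apply: commrM; last exact: commrV.
  by apply: comm_Zev; apply: commr_sym.
by rewrite mulrA c3 -mulrA mulrV // mulr1.
Qed.

(** For i = n - m the product Z_0 ... Z_(i-1) contains Z_s exactly when s < i. [ztU] is the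
    complementary factor in row m + 1, so that the two multiply to z - x1. *)
Definition ztT m := Zpoly (s < n - m)%N.
Definition zpT m := Zpoly (n - m == s)%N.
Definition yU m k := p m k + 1.
Definition lU m := I m.
Definition ztU m := Zpoly (m < s)%N.
Definition zpU m := Zpoly (m == s)%N.

Let gT := diag_series lT yT cT ztT.
Let gU := diag_series lU yU p ztU.
Let leftT := left_series lT yT cT UT.
Let rightT := right_series lT yT cT VT.
Let leftU := left_series lU yU p raise.
Let rightU := right_series lU yU p lower.

(** For 0 < j < n the multiplicity a_j is min(j, r, s, n - j), hence positive. *)
Lemma lT_neq0 m : (0 < m < n)%N -> lT m != [::].
Proof.
move=> hm; rewrite /lT; have := aE (leq_subr m n).
by case: (a _) => // h; exfalso; move: h; rewrite /n in hm *; lia.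
Qed.
Lemma lU_neq0 m : (0 < m < n)%N -> lU m != [::].
Proof.
move=> hm; rewrite /lU; have := @aE m (ltac:(lia)).
by case: (a _) => // h; exfalso; move: h; rewrite /n in hm *; lia.
Qed.

Lemma ztT_central m x : GRing.comm (lpoly (ztT m)) x.
Proof. by apply: central_lpoly => *; apply: Zpoly_central. Qed.
Lemma ztU_central m x : GRing.comm (lpoly (ztU m)) x.
Proof. by apply: central_lpoly => *; apply: Zpoly_central. Qed.

Lemma lT_mem_yc m m' t u : (m <= n)%N -> (m' <= n)%N -> t \in lT m -> u \in lT m' ->
  GRing.comm (yT m t) (yT m' u).
Proof. by move=> *; apply: pc => //; apply: leq_subr. Qed.

Lemma lT_unit m t u : (m <= n)%N -> t \in lT m -> u \in lT m -> t != u ->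
  yT m t - yT m u \is a GRing.unit.
Proof.
move=> mn tl ul tu; have := @pu (n - m) t u 0 (leq_subr _ _) tl ul tu.
by rewrite addr0.
Qed.

Lemma lU_mem_yc m m' t u : (m <= n)%N -> (m' <= n)%N -> t \in lU m -> u \in lU m' ->
  GRing.comm (yU m t) (yU m' u).
Proof.
move=> *; apply: commrD; last exact: commr1.
by apply: commr_sym; apply: commrD; [exact: pc|exact: commr1].
Qed.

Lemma lU_unit m t u : (m <= n)%N -> t \in lU m -> u \in lU m -> t != u ->
  yU m t - yU m u \is a GRing.unit.
Proof.
move=> mn tl ul tu; have := @pu m t u 0 mn tl ul tu.
by rewrite addr0 /yU opprD addrACA subrr addr0.
Qed.

Lemma sub_eq m m' : (m <= n)%N -> (m' <= n)%N -> (n - m == n - m')%N = (m == m').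
Proof. by move=> *; lia. Qed.

Lemma UT_comm m k m' t : (m <= n)%N -> (m' <= n)%N -> k \in lT m -> t \in lT m' ->
  (m, k) != (m', t) -> GRing.comm (UT m k) (yT m' t).
Proof.
move=> mn m'n kl tl; rewrite xpair_eqE -sub_eq // => ne.
by apply: lower_comm; rewrite ?leq_subr ?xpair_eqE.
Qed.

Lemma raise_commU m k m' t : (m <= n)%N -> (m' <= n)%N -> k \in lU m -> t \in lU m' ->
  (m, k) != (m', t) -> GRing.comm (raise m k) (yU m' t).
Proof. by move=> *; apply: commrD; [exact: raise_comm|exact: commr1]. Qed.

Lemma UT_y m k : (m <= n)%N -> k \in lT m -> UT m k * yT m k = cT m k * UT m k.
Proof. by move=> mn kl; apply: lower_p; rewrite ?leq_subr. Qed.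

Lemma raise_y m k : (m <= n)%N -> k \in lU m -> raise m k * yU m k = p m k * raise m k.
Proof. by move=> mn kl; rewrite /yU mulrDr mulr1 raise_p // mulrBl mul1r subrK. Qed.

Lemma chainT_poly (m0 m1 : nat) : (m0 < n)%N -> (m1 < n)%N ->
  is_lpoly (\sum_(maxn m0 m1 <= m < n) leftT m0 m * (gT m * rightT m1 m)).
Proof.
apply: (@chain_sum_poly R n lT yT cT 1 UT VT (fun=> iota_uniq _ _) (@commr1 R) (fun _ _ => erefl)
  lT_mem_yc lT_unit UT_y UT_comm zpT ztT (fun=> Zpoly_central _) ztT_central).
- move=> m mn; rewrite /ztT /zpT.
  case: (ltngtP (n - m.+1)%N s) => h.
  + by rewrite (_ : (s < n - m)%N = false) ?mulr1 //; lia.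
  + by rewrite (_ : (s < n - m)%N = true) ?mulr1 //; lia.
  + by rewrite (_ : (s < n - m)%N = true) ?mul1r //; lia.
- move=> m k mn kl; rewrite /zpT Zpoly_eval.
  have := @lower_raise (n - m) k (leq_subr _ _) kl.
  rewrite /UT /VT /Prev /cT /yT => ->; congr (_ * _^-1).
  by apply: eq_bigr => t _; rewrite opprD addrACA subrr addr0.
- exact: lT_neq0.
- by rewrite /lT subnn; have := aE (leq0n n); case: (a 0).
Qed.

Lemma chainU_poly (m0 m1 : nat) : (m0 < n)%N -> (m1 < n)%N ->
  is_lpoly (\sum_(maxn m0 m1 <= m < n) leftU m0 m * (gU m * rightU m1 m)).
Proof.
apply: (@chain_sum_poly R n lU yU p (-1) raise lower (fun=> iota_uniq _ _) (@commrN1 R)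
  (fun _ _ => esym (addrK _ _))
  lU_mem_yc lU_unit raise_y raise_commU zpU ztU (fun=> Zpoly_central _) ztU_central).
- move=> m mn; rewrite /ztU /zpU.
  case: (ltngtP m.+1 s) => h.
  + by rewrite mulr1.
  + by rewrite mulr1.
  + by rewrite mul1r.
- move=> m k mn kl; rewrite /zpU Zpoly_eval.
  rewrite -(raise_lower (ltnW mn) kl); congr (_ * _).
  by apply: eq_bigr => t _; rewrite /yU sub_shift.
- exact: lU_neq0.
- by rewrite /lU; have := aE (leqnn n); case: (a n) => //= k; rewrite /n; lia.
Qed.

Lemma lmonic_Zpoly b : lmonic (if b then 1 else 0) (lpoly (Zpoly b)).
Proof.
rewrite /Zpoly /Zlin; case: b; last by rewrite rmorph1; exact: lmonic1.
by rewrite rmorphB /= lpolyX lpolyC; exact: lmonic_lin.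
Qed.

(** With i = n - m the degree is a_i - a_(i-1) + [s < i], and [aE] gives a_i - a_(i-1) = 1 - [s < i]
    - [r < i]. *)
Lemma gT_monic m : (m < n)%N -> lmonic (if (n - m <= r)%N then 1 else 0) (gT m).
Proof.
move=> mn; rewrite /gT /diag_series.
have -> : (if (n - m <= r)%N then 1 else 0) =
   (1 *+ size (lT m) + (-1) *+ size (lT m.+1)) + (if (s < n - m)%N then 1 else 0) :> int.
  rewrite /lT !size_iota mulNrn !pmulrn !intz.
  have := aE (leq_subr m n); have := aE (leq_subr m.+1 n).
  by move: mn; rewrite /n => *; do 2 case: ifP => ?; lia.
apply: lmonicM; last exact: lmonic_Zpoly.
by apply: lmonicM; apply: lmonic_prod => t; [exact: lmonic_lin|exact: lmonic_linv].
Qed.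

(** Complementary to the degree of g_(m+1), in accordance with the product z - x1 of the two
    diagonal entries. *)
Lemma gU_monic m : (m < n)%N -> lmonic (if (m < r)%N then 0 else 1) (gU m).
Proof.
move=> mn; rewrite /gU /diag_series.
have -> : (if (m < r)%N then 0 else 1) =
   (1 *+ size (lU m) + (-1) *+ size (lU m.+1)) + (if (m < s)%N then 1 else 0) :> int.
  rewrite /lU !size_iota mulNrn !pmulrn !intz.
  have := aE (ltnW mn); have := aE mn.
  by move: mn; rewrite /n => *; do 2 case: ifP => ?; lia.
apply: lmonicM; last exact: lmonic_Zpoly.
by apply: lmonicM; apply: lmonic_prod => t; [exact: lmonic_lin|exact: lmonic_linv].
Qed.

Lemma chainT_deg (m0 m1 : nat) (e : int) : (m0 < n)%N -> (m1 < n)%N ->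
  (if (n - maxn m0 m1 <= r)%N then 1 else 0) - 1 <= e -> - 1 <= e ->
  ldeg_le e (\sum_(maxn m0 m1 <= m < n) leftT m0 m * (gT m * rightT m1 m) - (m0 == m1)%:R * gT m0).
Proof.
have d1 m : (m < n)%N -> (if (n - m <= r)%N then 1 else 0) <= 1 :> int by case: ifP.
move=> h0 h1 he he'; exact: (@chain_sum_deg R n lT yT cT UT VT ztT _ gT_monic d1 m0 m1 e h0 h1 he he').
Qed.

Lemma chainU_deg (m0 m1 : nat) (e : int) : (m0 < n)%N -> (m1 < n)%N ->
  (if (maxn m0 m1 < r)%N then 0 else 1) - 1 <= e -> - 1 <= e ->
  ldeg_le e (\sum_(maxn m0 m1 <= m < n) leftU m0 m * (gU m * rightU m1 m) - (m0 == m1)%:R * gU m0).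
Proof.
have d1 m : (m < n)%N -> (if (m < r)%N then 0 else 1) <= 1 :> int by case: ifP.
move=> h0 h1 he he'; exact: (@chain_sum_deg R n lU yU p raise lower ztU _ gU_monic d1 m0 m1 e h0 h1 he he').
Qed.

(** * The Gauss factors, their inverses and the product T' T *)

Notation L := (laurent R).

(* Row [i] of these matrices is row [i.+1] of the paper; [mT'] is (z - x1) T^-1. *)
Definition mE : 'M[L]_n := \matrix_(i, j) if (i <= j)%N then rightT (n - j.+1) (n - i.+1) else 0.
Definition mF : 'M[L]_n := \matrix_(i, j) if (j <= i)%N then leftT (n - i.+1) (n - j.+1) else 0.
Definition mG : 'rV[L]_n := \row_k gT (n - k.+1).
Definition mE' : 'M[L]_n := \matrix_(i, j) if (i <= j)%N then leftU i j else 0.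
Definition mF' : 'M[L]_n := \matrix_(i, j) if (j <= i)%N then rightU j i else 0.
Definition mG' : 'rV[L]_n := \row_k gU k.
Definition mT := mF *m (diag_mx mG *m mE).
Definition mT' := mE' *m (diag_mx mG' *m mF').

Lemma sum_truncate (m0 m1 : nat) (f g h : nat -> L) : (m0 < n)%N -> (m1 < n)%N ->
  \sum_(0 <= m < n) (if (m0 <= m)%N then f m else 0) * (g m * (if (m1 <= m)%N then h m else 0)) =
  \sum_(maxn m0 m1 <= m < n) f m * (g m * h m).
Proof.
move=> h0 h1; have hM : (maxn m0 m1 <= n)%N by lia.
rewrite (big_cat_nat (leq0n _) hM) /= [X in X + _]big1_seq ?add0r; last first.
  move=> m /andP[_]; rewrite mem_index_iota => hm.
  case: (leqP m0 m) => [?|?]; last by rewrite mul0r.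
  by rewrite ifF ?mulr0 //; lia.
by apply: eq_big_nat => m hm; rewrite !ifT //; lia.
Qed.

Lemma mTE (i j : 'I_n) : mT i j =
  \sum_(maxn (n - i.+1) (n - j.+1) <= m < n) leftT (n - i.+1) m * (gT m * rightT (n - j.+1) m).
Proof.
rewrite -sum_truncate; try by (have := ltn_ord i; lia).
(* Row k of the matrices is the chain node n - k - 1, so the sum is reversed. *)
rewrite mxE big_mkord (reindex_inj rev_ord_inj) /=; apply: eq_bigr => k _.
rewrite mul_diag_mx !mxE /=.
have hk : (n - (n - k.+1).+1 = k)%N by have := ltn_ord k; lia.
rewrite hk; congr (_ * (_ * _)); congr (if _ then _ else _).
  by have := ltn_ord k; have := ltn_ord i; lia.
by have := ltn_ord k; have := ltn_ord j; lia.
Qed.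

Lemma mTE' (i j : 'I_n) : mT' i j =
  \sum_(maxn i j <= m < n) leftU i m * (gU m * rightU j m).
Proof.
rewrite -sum_truncate ?ltn_ord //.
by rewrite mxE big_mkord; apply: eq_bigr => k _; rewrite mul_diag_mx !mxE.
Qed.

(** This is [chain_inverse] in the frame of T', with the right series of T as [rt]. The left series
    is the left factor, so E' appears as a left inverse of E. *)
Lemma mE'E : mE' *m mE = 1%:M.
Proof.
apply/matrixP => i j; rewrite !mxE.
have ni := ltn_ord i; have nj := ltn_ord j.
under eq_bigr => k _ do rewrite !mxE.
have [ij|ji|e] := ltngtP i j.
- rewrite (_ : (i == j) = false); last by apply/eqP => e; rewrite e ltnn in ij.
  have hj : (j < n)%N by [].
  rewrite -(big_mkord xpredT (fun k => (if (i <= k)%N then leftU i k else 0) *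
     (if (k <= j)%N then rightT (n - j.+1) (n - k.+1) else 0))).
  rewrite (big_cat_nat (leq0n i)) /=; last exact: ltnW.
  rewrite [X in X + _]big1_seq ?add0r; last first.
    by move=> k /andP[_]; rewrite mem_index_iota => hk; rewrite ifF ?mul0r //; lia.
  rewrite (@big_cat_nat _ _ _ j.+1) /=; [|by lia|by lia].
  rewrite [X in _ + X]big1_seq ?addr0; last first.
    move=> k /andP[_]; rewrite mem_index_iota => hk.
    by rewrite [X in _ * X]ifF ?mulr0 //; lia.
  rewrite (@eq_big_nat _ _ _ _ _ _ (fun k => leftU i k * rightT (n - j.+1) (n - k.+1))); last first.
    by move=> k hk; rewrite !ifT //; lia.
  apply: (@chain_inverse R n lU yU p (-1) raise (fun=> iota_uniq _ _) (@commrN1 R)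
    (fun _ _ => esym (addrK _ _)) lU_mem_yc raise_y raise_commU
    (fun m k => right_coef lT yT cT VT (n - j.+1) (n - m) k) i j).
  + by rewrite ij.
  + move=> k; rewrite (_ : (n - j = (n - j.+1).+1)%N); last by lia.
    by rewrite /= eqxx.
  + move=> m k mj; rewrite (_ : (n - m = (n - m.+1).+1)%N); last by lia.
    rewrite /= ifF; last by lia.
    have e1 : (n - (n - m.+1) = m.+1)%N by lia.
    have e2 : (n - (n - m.+1).+1 = m)%N by lia.
    rewrite /lT e1 e2; apply: eq_bigr => u _.
    by rewrite /VT e1; congr (_ * _); apply: eq_bigr => t _; rewrite /yT /cT /yU e1 e2.
  + by rewrite /rightT /right_series eqxx.
  + move=> m mj; rewrite /rightT /right_series ifF; last by lia.
    have e1 : (n - (n - m.+1) = m.+1)%N by lia.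
    have e2 : (n - (n - m.+1).+1 = m)%N by lia.
    rewrite /lT e1 e2; congr (- _); apply: eq_bigr => u _.
    by rewrite /VT /yT e1 /cT e2.
- rewrite (_ : (i == j) = false); last by apply/eqP => e; rewrite e ltnn in ji.
  apply: big1 => k _; case: leqP => ik; last by rewrite mul0r.
  by rewrite ifF ?mulr0 //; lia.
- have -> : i = j by apply: val_inj.
  rewrite eqxx (bigD1 j) //= leqnn /leftU /rightT /left_series /right_series !eqxx mulr1.
  rewrite big1 ?addr0 // => k kj.
  have kj' : (k : nat) != j by apply: contraNneq kj => e'; apply/eqP/val_inj.
  have [jk|kj''] := leqP j k; last by rewrite mul0r.
  by rewrite [X in _ * X]ifF ?mulr0 //; lia.
Qed.

(** The mirror case in the frame of T. Here the left series is F itself, so F' comes out as a right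
    inverse, whereas T' T needs F' F; [mF'F] turns it round. *)
Lemma mFF' : mF *m mF' = 1%:M.
Proof.
apply/matrixP => i j; rewrite !mxE.
have ni := ltn_ord i; have nj := ltn_ord j.
under eq_bigr => k _ do rewrite !mxE.
have [ij|ji|e] := ltngtP i j.
- rewrite (_ : (i == j) = false); last by apply/eqP => e; rewrite e ltnn in ij.
  apply: big1 => k _; case: leqP => ik; last by rewrite mul0r.
  by rewrite ifF ?mulr0 //; lia.
- rewrite (_ : (i == j) = false); last by apply/eqP => e; rewrite e ltnn in ji.
  rewrite (reindex_inj rev_ord_inj) /=.
  rewrite -(big_mkord xpredT (fun k => (if (n - k.+1 <= i)%N then leftT (n - i.+1) (n - (n - k.+1).+1) else 0) *
     (if (j <= n - k.+1)%N then rightU j (n - k.+1) else 0))).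
  rewrite (@big_cat_nat _ _ _ (n - i.+1) 0) //=; last by lia.
  rewrite [X in X + _]big1_seq ?add0r; last first.
    by move=> k /andP[_]; rewrite mem_index_iota => hk; rewrite ifF ?mul0r //; lia.
  rewrite (@big_cat_nat _ _ _ (n - j.+1).+1) /=; [|by lia|by lia].
  rewrite [X in _ + X]big1_seq ?addr0; last first.
    move=> k /andP[_]; rewrite mem_index_iota => hk.
    by rewrite [X in _ * X]ifF ?mulr0 //; lia.
  rewrite (@eq_big_nat _ _ _ _ _ _ (fun k => leftT (n - i.+1) k * rightU j (n - k.+1))); last first.
    move=> k hk; rewrite !ifT; try lia.
    by congr (leftT _ _ * _); lia.
  apply: (@chain_inverse R n lT yT cT 1 UT (fun=> iota_uniq _ _) (@commr1 R)
    (fun _ _ => erefl) lT_mem_yc UT_y UT_comm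
    (fun m k => right_coef lU yU p lower j (n - m) k) (n - i.+1) (n - j.+1)).
  + by lia.
  + move=> k; rewrite (_ : (n - (n - j.+1) = j.+1)%N); last by lia.
    by rewrite /= eqxx.
  + move=> m k mj; rewrite (_ : (n - m = (n - m.+1).+1)%N); last by lia.
    rewrite /= ifF; last by lia.
    rewrite /lU /lT; apply: eq_bigr => u _.
    rewrite /UT; congr (_ * _); rewrite (_ : (n - m = (n - m.+1).+1)%N); last by lia.
    apply: eq_bigr => t _; rewrite /yT /cT /yU.
    by rewrite (_ : (n - m = (n - m.+1).+1)%N); last by lia.
  + rewrite (_ : (n - (n - j.+1).+1 = j)%N); last by lia.
    by rewrite /rightU /right_series eqxx.
  + move=> m mj; rewrite /rightU /right_series ifF; last by lia.
    rewrite (_ : (n - m.+1).+1 = (n - m)%N); last by lia.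
    by [].
- have -> : i = j by apply: val_inj.
  rewrite eqxx (bigD1 j) //= leqnn /leftT /rightU /left_series /right_series !eqxx mulr1.
  rewrite big1 ?addr0 // => k kj.
  have kj' : (k : nat) != j by apply: contraNneq kj => e'; apply/eqP/val_inj.
  have [jk|kj''] := leqP k j; last by rewrite mul0r.
  by rewrite [X in _ * X]ifF ?mulr0 //; lia.
Qed.

Lemma mF'F : mF' *m mF = 1%:M.
Proof.
apply: unitriangular_inverse mFF' => [i j ij|i]; rewrite mxE; first by rewrite ifF //; lia.
by rewrite leqnn /leftT /left_series eqxx.
Qed.

Let zx1 : L := lZ1 R - lC x1%:A.

(** Linear factors and resolvents cancel in pairs, and exactly one of k < s and s <= k supplies the
    factor z - x1. *)
Lemma gUgT k : (k < n)%N -> gU k * gT (n - k.+1) = zx1.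
Proof.
move=> kn; rewrite /gU /gT /diag_series.
have e1 : (n - (n - k.+1) = k.+1)%N by lia.
have e2 : (n - (n - k.+1).+1 = k)%N by lia.
rewrite /lT /yT /cT /ztT e1 e2 /lU /yU /ztU.
set A := \prod_(t <- I k) _; set B := \prod_(t <- I k.+1) linv _.
set C := \prod_(t <- I k.+1) _; set D := \prod_(t <- I k) linv _.
have [BC _] : B * C = 1 /\ C * B = 1.
  by apply: prod_resolvents => t u tI uI; apply: pc.
have [_ AD] : D * A = 1 /\ A * D = 1.
  apply: prod_resolvents => t u tI uI; apply: (@lU_mem_yc k k) => //; exact: ltnW.
have -> : A * B * lpoly (Zpoly (k < s)%N) * (C * D * lpoly (Zpoly (s < k.+1)%N)) =
   A * (B * C) * D * (lpoly (Zpoly (k < s)%N) * lpoly (Zpoly (s < k.+1)%N)).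
  have zc := @central_lpoly R _ (C * D) (Zpoly_central (k < s)%N).
  by rewrite -[A * B * _ * _]mulrA [lpoly _ * (C * D * _)]mulrA zc !mulrA.
rewrite BC mulr1 AD mul1r /zx1 ltnS.
have ZE : lpoly Zlin = lZ1 R - lC x1%:A by rewrite rmorphB /= lpolyX lpolyC.
by case: leqP => _; rewrite /Zpoly rmorph1 ?mulr1 ?mul1r.
Qed.

Lemma mT'T (i j : 'I_n) : (mT' *m mT) i j = zx1 * (i == j)%:R.
Proof.
rewrite /mT' /mT -mulmxA -mulmxA.
rewrite [mF' *m _]mulmxA mF'F mul1mx.
have -> : diag_mx mG' *m (diag_mx mG *m mE) = \matrix_(u, v) (zx1 * mE u v).
  apply/matrixP => u v; rewrite !mul_diag_mx !mxE mulrA gUgT //.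
rewrite mxE.
have -> : (i == j)%:R = (mE' *m mE) i j by rewrite mE'E mxE.
rewrite [in RHS]mxE mulr_sumr; apply: eq_bigr => k _.
rewrite [X in _ * X]mxE !mulrA; congr (_ * _).
have zc : GRing.comm zx1 (mE' i k).
  apply/commr_sym/commrB; first by apply/commr_sym; apply: lZ1_comm.
  apply: commr_sym; have -> : lC x1%:A = lpoly (x1%:A)%:P :> L by rewrite lpolyC.
  apply: central_lpoly => u b; rewrite coefC; case: ifP => _; last exact/commr_sym/commr0.
  by rewrite /GRing.comm mulr_algl mulr_algr.
by rewrite zc.
Qed.

Lemma laurent_of_gD i : (0 < i <= n)%N -> laurent_of (gD a p x1 s i) = gT (n - i).
Proof.
move=> /andP[i0 i_n]; rewrite /gD !laurent_of_mul /gT /diag_series.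
have e1 : (n - (n - i) = i)%N by lia.
have e2 : (n - (n - i).+1 = i.-1)%N by lia.
rewrite /lT /yT /cT /ztT e1 e2 mulrA; congr (_ * _ * _).
- rewrite /lPoly laurent_of_prod big_map; apply: eq_bigr => t _; exact: laurent_of_lin.
- rewrite /lInvShift laurent_of_prod big_map; apply: eq_bigr => t _.
  by rewrite addrC.
rewrite laurent_of_prod big_map.
have -> : \prod_(k <- iota 0 i) laurent_of (lZ R x1 s k) =
   \prod_(k <- iota 0 i) lpoly (Zpoly (k == s)).
  apply: eq_bigr => k _; rewrite /lZ /Zpoly; case: ifP => _; last by rewrite rmorph1.
  by rewrite laurent_of_lin rmorphB /= lpolyX lpolyC.
elim: (i) => [|k IH]; first by rewrite big_nil rmorph1.
rewrite -addn1 iotaD big_cat /= big_seq1 IH add0n addn1.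
case: (ltngtP s k) => h.
- by rewrite (_ : (s < k.+1)%N = true) ?rmorph1 ?mulr1 //; lia.
- by rewrite (_ : (s < k.+1)%N = false) ?rmorph1 ?mulr1 //; lia.
- by rewrite (_ : (s < k.+1)%N = true) ?rmorph1 ?mul1r //; lia.
Qed.

Lemma TD_entry (i j : 'I_n) : laurent_of (TD a p eq eqi x1 s i.+1 j.+1) = mT i j.
Proof.
have ni := ltn_ord i; have nj := ltn_ord j.
rewrite mTE /TD laurent_of_sum big_map.
have -> : maxn (n - i.+1) (n - j.+1) = (n - minn i.+1 j.+1)%N by lia.
have -> : \sum_(k <- iota 1 (minn i.+1 j.+1))
     laurent_of (lmul (fD a p eqi i.+1 k) (lmul (gD a p x1 s k) (eD a p eq x1 s k j.+1))) =
   \sum_(k <- iota 1 (minn i.+1 j.+1))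
     leftT (n - i.+1) (n - k) * (gT (n - k) * rightT (n - j.+1) (n - k)).
  apply: eq_big_seq => k; rewrite mem_iota => hk.
  rewrite laurent_of_mul [laurent_of (lmul (gD _ _ _ _ _) _)]laurent_of_mul laurent_of_gD; last by lia.
  congr (_ * (_ * _)).
    have [->|ne] := eqVneq k i.+1; first by rewrite /fD eqxx /leftT /left_series eqxx.
    by apply: laurent_of_fD => //; lia.
  have [->|ne] := eqVneq k j.+1; first by rewrite /eD eqxx /rightT /right_series eqxx.
  by apply: laurent_of_eD => //; lia.
set q := minn _ _; have : (q <= n)%N by rewrite /q; lia.
elim: q => [|q IH] qn; first by rewrite big_nil subn0 big_geq.
have -> : iota 1 q.+1 = iota 1 q ++ [:: q.+1] by have := iotaD 1 q 1; rewrite addn1 add1n.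
rewrite big_cat /= big_seq1 IH; last exact: ltnW.
rewrite addrC [RHS]big_ltn; last by lia.
by rewrite (_ : (n - q.+1).+1 = (n - q)%N); last by lia.
Qed.

(** * Constant and identity blocks from polynomiality and degree *)

Lemma lpoly_const (x : L) (k : int) : is_lpoly x -> ldeg_le 0 x -> k != 0 -> x k = 0.
Proof.
move=> [f ->] hd k0; have [h|h] := ltP 0 k; first exact: hd.
by rewrite lpoly_coef; case: k k0 h => [[|k]|k].
Qed.

Lemma lpoly_deg_lt0 (x : L) : is_lpoly x -> ldeg_le (-1) x -> x = 0.
Proof.
move=> xp xd; apply: laurentP => k; rewrite laurent0.
have [->|k0] := eqVneq k 0; first exact: xd.
by apply: lpoly_const => //; apply: ldeg_leW xd.
Qed.

Lemma lmonic0_sub1 (x : L) : lmonic 0 x -> ldeg_le (-1) (x - 1).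
Proof.
move=> [xd x1'] k hk; rewrite laurentD laurentN -lC1 lC_coef.
have [->|k0] := eqVneq k 0; first by rewrite x1' subrr.
by rewrite subr0 xd //; lia.
Qed.

Lemma is_lpoly_nat (m : nat) : is_lpoly (m%:R : L).
Proof. by exists m%:R; rewrite rmorph_nat. Qed.

Lemma mT_poly (i j : 'I_n) : is_lpoly (mT i j).
Proof. by rewrite mTE; apply: chainT_poly; have := ltn_ord i; lia. Qed.

(** The leading summand is row min(i, j), where the diagonal entry has degree 1. One off-diagonal
    factor brings this down to 0, and a polynomial of degree at most 0 is constant. *)
Lemma mT_offdiag (i j : 'I_n) (k : int) : (minn i j < r)%N -> i != j -> k != 0 -> mT i j k = 0.
Proof.
have ni := ltn_ord i; have nj := ltn_ord j => ijr ij; apply: lpoly_const; first exact: mT_poly.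
have ij' : (i : nat) != j by apply: contraNneq ij => e; apply/eqP/val_inj.
have := @chainT_deg (n - i.+1) (n - j.+1) 0; rewrite -mTE.
rewrite (_ : (n - i.+1 == n - j.+1)%N = false) ?mul0r ?subr0; last by lia.
by apply; try lia; rewrite ifT //; lia.
Qed.

(** The leading coefficient 1 is what cancels z in F. *)
Lemma mT_diag (i : 'I_n) : (i < r)%N -> lmonic 1 (mT i i).
Proof.
move=> ir; have ni := ltn_ord i.
have [gd g1] : lmonic 1 (gT (n - i.+1)).
  have := @gT_monic (n - i.+1); rewrite (_ : (n - (n - i.+1) <= r)%N = true); last by lia.
  by apply; lia.
have := @chainT_deg (n - i.+1) (n - i.+1) 0; rewrite -mTE eqxx mul1r maxnn.
rewrite (_ : (n - (n - i.+1) <= r)%N = true); last by lia.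
move=> h; have {}h : ldeg_le 0 (mT i i - gT (n - i.+1)) by apply: h; lia.
have E k : 0 < k -> mT i i k = gT (n - i.+1) k.
  by move=> k0; have := h k k0; rewrite laurentD laurentN => /eqP; rewrite subr_eq0 => /eqP.
by split=> [k hk|]; rewrite E // ?gd //; lia.
Qed.

(** In these rows the diagonal entries of G are monic of degree 0, so the difference of the two
    sides is a polynomial of degree at most -1, hence 0. *)
Lemma mT_lower_block (i j : 'I_n) : (r <= i)%N -> (r <= j)%N -> mT i j = (i == j)%:R.
Proof.
move=> ri rj; have ni := ltn_ord i; have nj := ltn_ord j.
apply/eqP; rewrite -subr_eq0; apply/eqP/lpoly_deg_lt0.
  by apply: is_lpolyD; [exact: mT_poly|apply/is_lpolyN/is_lpoly_nat].
have := @chainT_deg (n - i.+1) (n - j.+1) (-1); rewrite -mTE.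
rewrite (_ : (n - maxn (n - i.+1) (n - j.+1) <= r)%N = false); last by lia.
move=> /(_ (ltac:(lia)) (ltac:(lia)) isT isT).
have [->|ij] := eqVneq i j; last first.
  have ij' : (i : nat) != j by apply: contraNneq ij => e; apply/eqP/val_inj.
  by rewrite (_ : (n - i.+1 == n - j.+1)%N = false) ?mul0r //; lia.
rewrite eqxx mul1r => h.
have -> : mT j j - 1%:R = (mT j j - gT (n - j.+1)) + (gT (n - j.+1) - 1) by rewrite addrA subrK.
apply: ldeg_leD => //; apply: lmonic0_sub1.
have := @gT_monic (n - j.+1); rewrite (_ : (n - (n - j.+1) <= r)%N = false); last by lia.
by apply; lia.
Qed.

(** The argument of [mT_lower_block] for T', whose diagonal entries have degree 0 in the first r
    rows. *)
Lemma mT'_upper_block (i j : 'I_n) : (i < r)%N -> (j < r)%N -> mT' i j = (i == j)%:R.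
Proof.
move=> ri rj; have ni := ltn_ord i; have nj := ltn_ord j.
apply/eqP; rewrite -subr_eq0; apply/eqP/lpoly_deg_lt0.
  apply: is_lpolyD; last exact/is_lpolyN/is_lpoly_nat.
  by rewrite mTE'; apply: chainU_poly.
have := @chainU_deg i j (-1) ni nj; rewrite -mTE'.
rewrite (_ : (maxn i j < r)%N = true); last by lia.
move=> /(_ isT isT).
have [->|ij] := eqVneq i j; last first.
  have ij' : (i : nat) != j by apply: contraNneq ij => e; apply/eqP/val_inj.
  by rewrite (_ : (i == j :> nat) = false) ?mul0r //; lia.
rewrite eqxx mul1r => h.
have -> : mT' j j - 1%:R = (mT' j j - gU j) + (gU j - 1) by rewrite addrA subrK.
apply: ldeg_leD => //; apply: lmonic0_sub1.
by have := gU_monic nj; rewrite rj.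
Qed.

Lemma block_identity (i j : 'I_r) :
  mT (lshift s i) (lshift s j) = zx1 * (i == j)%:R +
  \sum_(q < s) mT (lshift s i) (rshift r q) * mT (rshift r q) (lshift s j).
Proof.
apply: (@schur_complement L r s mT mT' zx1) => [u v|u v|u v].
- exact: mT'T.
- by rewrite mT'_upper_block //= (inj_eq (@lshift_inj _ _)).
- by rewrite mT_lower_block ?leq_addr //= (inj_eq (@rshift_inj _ _)).
Qed.

Lemma lax_blocks :
  let T := TD a p eq eqi x1 s in
  let Q := fun al be => T al (r + be)%N in
  let P := fun al be => lopp (T (r + al)%N be) in
  let F := fun al be => ladd (if al == be then lz R else lzero R) (lopp (T al be)) in
  (forall al be, (1 <= al <= r)%N -> (1 <= be <= s)%N -> is_const (Q al be)) /\
  (forall al be, (1 <= al <= s)%N -> (1 <= be <= r)%N -> is_const (P al be)) /\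
  (forall al be, (1 <= al <= r)%N -> (1 <= be <= r)%N -> is_const (F al be)) /\
  (forall al be, (1 <= al <= r)%N -> (1 <= be <= r)%N ->
     lcoef (F al be) 0 =
     (al == be)%:R * x1%:A + \sum_(1 <= ga < s.+1) lcoef (Q al ga) 0 * lcoef (P ga be) 0).
Proof.
move=> T Q P F.
have TE al be (i j : 'I_n) k : al = i.+1 -> be = j.+1 -> lcoef (T al be) k = mT i j k.
  by move=> -> ->; rewrite -TD_entry.
have ordr al : (1 <= al <= r)%N -> exists i : 'I_r, al = i.+1.
  by move=> h; have h' : (al.-1 < r)%N by [lia]; exists (Ordinal h') => /=; lia.
have ords al : (1 <= al <= s)%N -> exists i : 'I_s, al = i.+1.
  by move=> h; have h' : (al.-1 < s)%N by [lia]; exists (Ordinal h') => /=; lia.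
split; [|split; [|split]].
- move=> al be /ordr[i ai] /ords[j bj] k k0.
  rewrite (TE _ _ (lshift s i) (rshift r j)) //=; last by lia.
  by apply: mT_offdiag; rewrite ?eq_lrshift //=; have := ltn_ord i; lia.
- move=> al be /ords[i ai] /ordr[j bj] k k0.
  rewrite lcoef_lopp (TE _ _ (rshift r i) (lshift s j)) //=; last by lia.
  by rewrite mT_offdiag ?oppr0 ?eq_rlshift //=; have := ltn_ord j; lia.
- move=> al be /ordr[i ai] /ordr[j bj] k k0.
  rewrite lcoef_ladd lcoef_lopp (TE _ _ (lshift s i) (lshift s j)) //.
  rewrite ai bj eqSS (inj_eq val_inj).
  have [<-|ij] := eqVneq i j; last first.
    rewrite lcoef_lconst if_same sub0r mT_offdiag ?oppr0 //=.
    by have := ltn_ord i; lia.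
  have [hd h1] := mT_diag (ltn_ord i : (lshift s i < r)%N).
  rewrite lcoef_lz; have [->|k1] := eqVneq k 1; first by rewrite h1 subrr.
  rewrite sub0r; have [k2|k2] := ltP 1 k; first by rewrite hd // oppr0.
  have [f ->] := mT_poly (lshift s i) (lshift s i).
  by rewrite lpoly_coef; case: k k0 k1 k2 => [[|[|k]]|k] //; rewrite oppr0.
move=> al be /ordr[i ai] /ordr[j bj].
rewrite lcoef_ladd lcoef_lopp (TE _ _ (lshift s i) (lshift s j)) // block_identity.
rewrite laurentD laurent_sum opprD -sumrN.
have -> : lcoef (if al == be then lz R else lzero R) 0 = 0.
  by case: ifP => _; rewrite ?lcoef_lz // lcoef_lconst.
rewrite add0r ai bj eqSS (inj_eq val_inj); congr (_ + _).
  case: (i == j); last by rewrite mulr0 laurent0 oppr0 mul0r.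
  by rewrite mulr1 mul1r /zx1 laurentD laurentN lZ1_coef lC_coef /= add0r opprK.
rewrite big_add1 -[s.+1.-1]/s big_mkord; apply: eq_bigr => q _.
(* As the lower left entry is constant, the coefficient of z^0 of each product in [block_identity]
   is the product of the coefficients of z^0. *)
have lower_const : mT (rshift r q) (lshift s j) = lC (mT (rshift r q) (lshift s j) 0).
  apply: laurentP => k; rewrite lC_coef; case: eqVneq => [->|k0] //.
  by rewrite mT_offdiag ?eq_rlshift //=; have := ltn_ord j; lia.
rewrite {1}lower_const lMC_coef -mulrN lcoef_lopp.
by rewrite (TE i.+1 (r + q.+1)%N (lshift s i) (rshift r q)) ?(TE (r + q.+1)%N j.+1 (rshift r q) (lshift s j)) //=; lia.
Qed.
End Main.

(** * The multiplicities a_j from the weight *)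

Section WeightMultiplicities.
Variables (r s : nat) (a : nat -> nat).
Hypotheses (ha0 : a 0%N = 0%N) (han : a (r + s)%N = 0%N).

Lemma sum_alpha j : (1 <= j <= r + s)%N ->
  \sum_(1 <= i < r + s) (a i)%:Z * alpha i j = (a j)%:Z - (a j.-1)%:Z.
Proof.
move=> hj; rewrite /alpha.
under eq_bigr => i _ do rewrite mulrBr.
rewrite sumrB; congr (_ - _).
  have -> : \sum_(1 <= i < r + s) (a i)%:Z * (j == i)%:Z = \sum_(1 <= i < r + s | i == j) (a i)%:Z.
    rewrite [RHS]big_mkcond /=; apply: eq_bigr => i _; rewrite eq_sym.
    by case: eqP; rewrite ?mulr1 ?mulr0.
  rewrite big_nat1_eq; case: ifP => // hn.
  rewrite (_ : j = (r + s)%N) ?han //; lia.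
have -> : \sum_(1 <= i < r + s) (a i)%:Z * (j == i.+1)%:Z =
    \sum_(1 <= i < r + s | i == j.-1) (a i)%:Z.
  rewrite [RHS]big_mkcond /=; apply: eq_bigr => i _.
  have -> : (j == i.+1) = (i == j.-1) by lia.
  by case: eqP; rewrite ?mulr1 ?mulr0.
rewrite big_nat1_eq; case: ifP => // hn.
by rewrite (_ : j.-1 = 0%N) ?ha0 //; lia.
Qed.

(** Coordinate j of the weight equation reads a_j - a_(j-1) = 1 - [s < j] - [r < j], and a_0 = 0
    starts the summation. *)
Lemma weight_multiplicity :
  (forall j : nat, (1 <= j <= r + s)%N ->
        \sum_(1 <= i < r + s) (a i)%:Z * alpha i j
        = varpi s j + (varpi r j - varpi 0 j)) ->
  forall j, (j <= r + s)%N -> (a j + (j - s) + (j - r) = j)%N.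
Proof.
move=> ha; elim=> [|j IH] hj; first by rewrite ha0.
have := ha j.+1; rewrite sum_alpha //= => /(_ hj).
have := IH (ltnW hj); rewrite /varpi /=.
case: (ltnP s j.+1) => h1; case: (ltnP r j.+1) => h2; lia.
Qed.
End WeightMultiplicities.

Theorem theorem2p49
  (r s : nat) (hr : (0 < r)%N) (hs : (0 < s)%N) (x1 : CC)
  (a : nat -> nat)
  (ha0 : a 0%N = 0%N) (han : a (r + s)%N = 0%N)
  (ha : forall j : nat, (1 <= j <= r + s)%N ->
        \sum_(1 <= i < r + s) (a i)%:Z * alpha i j
        = varpi s j + (varpi r j - varpi 0 j))
  (R : unitAlgType CC) (p eq eqi : nat -> nat -> R)
  (hpp : forall i k j l, (1 <= i < r + s)%N -> (1 <= k <= a i)%N ->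
         (1 <= j < r + s)%N -> (1 <= l <= a j)%N ->
         p i k * p j l = p j l * p i k)
  (hee : forall i k j l, (1 <= i < r + s)%N -> (1 <= k <= a i)%N ->
         (1 <= j < r + s)%N -> (1 <= l <= a j)%N ->
         eq i k * eq j l = eq j l * eq i k)
  (heinv : forall i k, (1 <= i < r + s)%N -> (1 <= k <= a i)%N ->
         eq i k * eqi i k = 1 /\ eqi i k * eq i k = 1)
  (hep : forall i k j l, (1 <= i < r + s)%N -> (1 <= k <= a i)%N ->
         (1 <= j < r + s)%N -> (1 <= l <= a j)%N ->
         eq i k * p j l - p j l * eq i k = - (((i == j) && (k == l))%:R * eq i k))
  (hepi : forall i k j l, (1 <= i < r + s)%N -> (1 <= k <= a i)%N ->
         (1 <= j < r + s)%N -> (1 <= l <= a j)%N ->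
         eqi i k * p j l - p j l * eqi i k = ((i == j) && (k == l))%:R * eqi i k)
  (hunit : forall i k l (m : int), (1 <= i < r + s)%N -> (1 <= k <= a i)%N ->
         (1 <= l <= a i)%N -> k != l ->
         (p i k - p i l + m%:~R) \is a GRing.unit) :
  let T := TD a p eq eqi x1 s in
  (* Q = upper-right r x s block, P = minus the lower-left s x r block *)
  let Q := fun al be => T al (r + be)%N in
  let P := fun al be => lopp (T (r + al)%N be) in
  let F := fun al be => ladd (if al == be then lz R else lzero R) (lopp (T al be)) in
  (forall al be, (1 <= al <= r)%N -> (1 <= be <= s)%N -> is_const (Q al be)) /\
  (forall al be, (1 <= al <= s)%N -> (1 <= be <= r)%N -> is_const (P al be)) /\
  (forall al be, (1 <= al <= r)%N -> (1 <= be <= r)%N -> is_const (F al be)) /\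
  (forall al be, (1 <= al <= r)%N -> (1 <= be <= r)%N ->
     lcoef (F al be) 0 =
     (al == be)%:R * x1%:A + \sum_(1 <= ga < s.+1) lcoef (Q al ga) 0 * lcoef (P ga be) 0).
Proof.
pose I i := iota 1 (a i).
(* [lax_blocks] asks for the relations at all nodes 0, ..., n. The end nodes carry no variables
   because a_0 = a_n = 0, so those relations are vacuous there. *)
have node i k : (i <= r + s)%N -> k \in I i -> (1 <= i < r + s)%N /\ (1 <= k <= a i)%N.
  rewrite mem_iota add1n ltnS => hi hk; split=> //.
  have ai : a i != 0%N by lia.
  have i0 : i != 0%N by apply: contraNneq ai => ->; rewrite ha0.
  have i1 : i != (r + s)%N by apply: contraNneq ai => ->; rewrite han.
  by lia.
have pairE i k j l : (i == j) && (k == l) = ((i, k) == (j, l)) by rewrite xpair_eqE.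
apply: lax_blocks => //.
- exact: (weight_multiplicity ha0 han ha).
- by move=> i k j l hi hj /(node _ _ hi)[? ?] /(node _ _ hj)[? ?]; apply: hpp.
- by move=> i k l m hi /(node _ _ hi)[? ?] /(node _ _ hi)[? ?]; apply: hunit.
- move=> i k j l hi hj /(node _ _ hi)[h1 h2] /(node _ _ hj)[h3 h4] ne.
  apply/eqP; rewrite -subr_eq0; apply/eqP; rewrite hep // pairE (negbTE ne) mul0r oppr0 //.
- move=> i k j l hi hj /(node _ _ hi)[h1 h2] /(node _ _ hj)[h3 h4] ne.
  apply/eqP; rewrite -subr_eq0; apply/eqP; rewrite hepi // pairE (negbTE ne) mul0r //.
- move=> i k j l hi hj /(node _ _ hi)[h1 h2] /(node _ _ hj)[h3 h4].
  have [e1 e2] := heinv i k h1 h2; have [e3 e4] := heinv j l h3 h4.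
  (* The e^(-q) commute because the e^q do: one exponential is inverted at a time. *)
  apply: (comm_inverse e3 e4); apply/commr_sym; apply: (comm_inverse e1 e2).
  by apply: hee.
- move=> i k hi /(node _ _ hi)[h1 h2].
  have := hep i k i k h1 h2 h1 h2; rewrite !eqxx mul1r => /eqP.
  by rewrite subr_eq addrC => /eqP ->; rewrite mulrBl mul1r.
- move=> i k hi /(node _ _ hi)[h1 h2].
  have := hepi i k i k h1 h2 h1 h2; rewrite !eqxx mul1r => /eqP.
  by rewrite subr_eq addrC => /eqP ->; rewrite mulrDl mul1r.
- by move=> i k hi /(node _ _ hi)[h1 h2]; case: (heinv i k h1 h2).
- by move=> i k hi /(node _ _ hi)[h1 h2]; case: (heinv i k h1 h2).
Qed.
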